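(* Let $\Lambda=(W,F)$ be an undirected graph and $(S_w)_{w\in W}$ a family of right LCM monoids. Let $(\Lambda_j)_{j\in J}$ be the coconnected components of $\Lambda$, so that $S(\Lambda)=\bigoplus_{j\in J}S(\Lambda_j)$, and for each $j\in J$ let $(\Gamma_i)_{i\in I_j}$, $\Gamma_i=(V_i,E_i)$, be the coconnected components of the core graph $\Gamma(S(\Lambda_j))$. Then: (i) $\mathcal{I}(S(\Lambda))=\bigsqcup_{j\in J}\Big(\mathcal{I}(S(\Lambda_j))\oplus\bigoplus_{j'\in J\setminus\{j\}}S(\Lambda_{j'})_c\Big)$. (ii) The coconnected components of $\Gamma(S(\Lambda))$ are edge-free if and only if the coconnected components of $\Gamma(S(\Lambda_j))$ are edge-free for all $j\in J$. (iii) $S(\Lambda)$ is noncore factorable if and only if $S(\Lambda_j)$ is noncore factorable for all $j\in J$. (iv) $S(\Lambda)$ has balanced factorization if and only if, for all $j\in J$, $S(\Lambda_j)$ has balanced factorization and the action $\alpha\colon S(\Lambda_j)_c\curvearrowright S(\Lambda_j)/_\sim$ restricts to an action on the vertex sets of the individual coconnected components of $\Gamma(S(\Lambda_j))$. In particular, the graph product $S(\Lambda)$ has a generalized scale if and only if for every $j\in J$ the coconnected components of $\Gamma(S(\Lambda_j))$ are edge-free, $S(\Lambda_j)$ is noncore factorable and $S(\Lambda_j)$ has balanced factorization, and moreover $(|V_i|)_{i\in\bigsqcup_{j\in J}I_j}\subset\mathbb{N}^\times\cup\{\infty\}$ freely generates a nontrivial submonoid of $\mathbb{N}^\times$.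
   Context: $\mathbb{N}^\times$ denotes the multiplicative monoid of positive integers. A right LCM monoid is a left cancellative monoid $S$ (with unit) in which the intersection $sS\cap tS$ of any two principal right ideals is either empty or again a principal right ideal. For $s,t\in S$ write $s\Cap t$ if $sS\cap tS\neq\emptyset$, and $s\perp t$ otherwise. The core of $S$ is $S_c:=\{a\in S\mid a\Cap s\text{ for all }s\in S\}$. Elements $s,t\in S$ are core equivalent, $s\sim t$, if there are $a,b\in S_c$ with $sa=tb$; this is an equivalence relation, and $[s]$ denotes the class of $s$. Left multiplication defines an action $\alpha\colon S_c\curvearrowright S/_\sim$ by bijections, $\alpha_a([s])=[as]$. A generalized scale on $S$ is a nontrivial homomorphism (not identically $1$) $N\colon S\to\mathbb{N}^\times$, $s\mapsto N_s$, such that: (1) $|N^{-1}(n)/_\sim|=n$ for all $n\in N(S)$; (2) $N_s=N_t$ implies $s\sim t$ or $s\perp t$; (3) for all $s\in S$ and $n\in N(S)$ there exists $t\in N^{-1}(n)$ with $s\Cap t$. An element $s\in S$ is noncore irreducible if $s\notin S_c$ and whenever $sa=tr$ for some $a\in S_c$ and $t,r\in S$, then $t\in S_c$ or $r\in S_c$. The set of noncore irreducible elements is denoted $\mathcal{I}(S)$; it is closed under $\sim$. The core graph $\Gamma(S)=(V,E)$ is the undirected simplicial graph with vertex set $V=\mathcal{I}(S)/_\sim$ and an edge between distinct vertices $[s],[t]$ if and only if $s\Cap t$. The coconnected components of an undirected graph $(V,E)$ are the full subgraphs $(V_i,(V_i\times V_i)\cap E)$ on the vertex sets $V_i$ of the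 connected components of the complementary graph $(V,V\times V\setminus E)$. A component is edge-free if its edge set is empty. For $s\in\mathcal{I}(S)$, $i(s)$ is the index of the coconnected component of $\Gamma(S)$ containing $[s]$. $S$ is noncore factorable if every element of $S\setminus S_c$ is core equivalent to a finite product of noncore irreducible elements. $S$ has balanced factorization if for all $s,t\in\mathcal{I}(S)$ with $i(s)\neq i(t)$ there are $s',t'\in\mathcal{I}(S)$ with $sS\cap tS=st'S$, $st'=ts'$, $i(s')=i(s)$ and $i(t')=i(t)$. A family $(n_i)_{i\in I}\subset\mathbb{N}^\times\cup\{\infty\}$ freely generates a nontrivial submonoid of $\mathbb{N}^\times$ if all $n_i$ are finite, the homomorphism from the free abelian monoid on $I$ to $\mathbb{N}^\times$ with $i\mapsto n_i$ is injective, and its image is not $\{1\}$. Given an undirected graph $\Lambda=(W,F)$ (without loops) and right LCM monoids $(S_w)_{w\in W}$, the graph product $S(\Lambda)=S(\Lambda,(S_w)_{w\in W})$ is the quotient of the free product of monoids $\ast_{w\in W}S_w$ by the congruence generated by $st=ts$ for $s\in S_v$, $t\in S_w$ with $(v,w)\in F$; it is again a right LCM monoid. $S(\Lambda_j)$ denotes the graph product over $\Lambda_j$ with the corresponding vertex monoids. $\bigoplus_{j\in J}$ denotes the restricted direct product (finitely supported families); in (i), the $j$-th set on the right consists of the finitely supported families with $j$-th entry in $\mathcal{I}(S(\Lambda_j))$ and all other entries in the respective cores $S(\Lambda_{j'})_c$. *)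

(* Defs.v *)
From HB Require Import structures.
From Stdlib Require Import Relation_Operators.
From mathcomp Require Import all_boot finmap multiset.
From mathcomp Require Import boolp classical_sets functions cardinality.

Set Implicit Arguments.
Unset Strict Implicit.
Unset Printing Implicit Defensive.

Local Open Scope classical_set_scope.
Local Open Scope card_scope.
Local Open Scope group_scope.
Local Open Scope quotient_scope.

Section RightLCM.
Variable M : monoidType.
Implicit Types s t a b r : M.

Definition rideal s : set M := range (fun x => s * x).

Definition right_LCM : Prop :=
  (forall s t r, s * t = s * r -> t = r) /\
  (forall s t, rideal s `&` rideal t = set0 \/
               exists r, rideal s `&` rideal t = rideal r).

Definition rmeets s t : Prop := rideal s `&` rideal t !=set0.

Definition perp s t : Prop := ~ rmeets s t.

Definition core : set M := [set a | forall s, rmeets a s].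

Definition core_eq s t : Prop :=
  exists a b, [/\ core a, core b & s * a = t * b].

Definition core_class s : set M := [set t | core_eq s t].

(* The elements of S/~ are represented as subsets of S.  On A = [s] the union
   below consists of copies of the single class [a s]. *)
Definition core_act a (A : set M) : set M := \bigcup_(s in A) core_class (a * s).

Definition is_generalized_scale (N : M -> nat) : Prop :=
  [/\ [/\ forall s, (0 < N s)%N, N 1 = 1%N,
          forall s t, N (s * t) = (N s * N t)%N & exists s, N s <> 1%N],
      forall n, range N n -> core_class @` (N @^-1` [set n]) #= `I_n,
      forall s t, N s = N t -> core_eq s t \/ perp s t &
      forall s n, range N n -> exists2 t, N t = n & rmeets s t].

Definition has_generalized_scale : Prop := exists N, is_generalized_scale N.

Definition noncore_irr : set M :=
  [set s | ~ core s /\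
     forall a t r, core a -> s * a = t * r -> core t \/ core r].

Definition noncore_factorable : Prop :=
  forall s, ~ core s ->
  exists l : seq M, (forall x, x \in l -> noncore_irr x) /\
                    core_eq s (\big[*%g/1]_(x <- l) x).

End RightLCM.

Arguments noncore_irr M : clear implicits.

Record graph := Graph {
  vertex :> choiceType;
  edge : vertex -> vertex -> Prop;
  edge_sym : forall u v, edge u v -> edge v u;
  edge_irr : forall u, ~ edge u u }.

Section Coconnected.
Variable G : graph.

Definition coconnected : G -> G -> Prop :=
  clos_refl_trans G (fun u v => ~ edge u v).

Definition coconn_comp (v : G) : set G := [set u | coconnected v u].

Definition coconn_comps : set (set G) := range coconn_comp.

Section FullSubgraph.
Variable A : set G.

Definition full_edge (u v : A) : Prop := edge (val u) (val v).

Lemma full_edge_sym u v : full_edge u v -> full_edge v u.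
Proof. exact: edge_sym. Qed.

Lemma full_edge_irr u : ~ full_edge u u.
Proof. exact: edge_irr. Qed.

Definition full_subgraph : graph := Graph full_edge_sym full_edge_irr.

End FullSubgraph.
End Coconnected.

Arguments coconn_comps G : clear implicits.

Definition edge_free (G : graph) : Prop := forall u v : G, ~ edge u v.

Definition edge_free_components (G : graph) : Prop :=
  forall C : coconn_comps G, edge_free (full_subgraph (val C)).

Section CoreGraph.
Variable M : monoidType.

Definition core_vertex := set_type (@core_class M @` noncore_irr M).

Definition irr_class (s : noncore_irr M) : core_vertex :=
  exist _ (core_class (val s)) (mem_set (imageP _ (set_mem (valP s)))).

Definition core_edge (u v : core_vertex) : Prop :=
  u <> v /\
  exists s t : noncore_irr M,
    [/\ u = irr_class s, v = irr_class t & rmeets (val s) (val t)].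

Lemma core_edge_sym u v : core_edge u v -> core_edge v u.
Proof.
move=> [uv [s [t [us vt st]]]]; split; first by move=> vu; exact: uv.
by exists t, s; split => //; rewrite /rmeets setIC.
Qed.

Lemma core_edge_irr u : ~ core_edge u u.
Proof. by case. Qed.

Definition core_graph : graph := Graph core_edge_sym core_edge_irr.

Definition irr_index (s : noncore_irr M) : set core_graph :=
  @coconn_comp core_graph (irr_class s).

Definition balanced_factorization : Prop :=
  forall s t : noncore_irr M, irr_index s <> irr_index t ->
  exists s' t' : noncore_irr M,
    [/\ rideal (val s) `&` rideal (val t) = rideal (val s * val t'),
        val s * val t' = val t * val s',
        irr_index s' = irr_index s & irr_index t' = irr_index t].

Definition core_act_restricts : Prop :=
  forall C : coconn_comps core_graph, forall a, core a ->
  forall v : core_graph, val C v ->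
  exists2 w : core_graph, val C w & val w = core_act a (val v).

End CoreGraph.

(* None stands for an infinite cardinality. *)
Definition ncard (T : choiceType) (A : set T) : option nat :=
  if pselect (finite_set A) then Some #|` fset_set A| else None.

(* The free abelian monoid on I is the type of finite multisets over I. *)
Definition freely_generates_nontrivial (I : choiceType) (n : I -> option nat) :
    Prop :=
  exists k : I -> nat,
  [/\ forall i, n i = Some (k i), forall i, (0 < k i)%N,
      injective (fun m : {mset I}%mset => (\prod_(i <- m) k i)%N) &
      exists m : {mset I}%mset, (\prod_(i <- m) k i)%N <> 1%N].

Inductive congruence_gen (M : monoidType) (R : M -> M -> Prop) :
    M -> M -> Prop :=
| cong_base x y : R x y -> congruence_gen R x y
| cong_refl x : congruence_gen R x x
| cong_sym x y : congruence_gen R x y -> congruence_gen R y x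
| cong_trans y x z :
    congruence_gen R x y -> congruence_gen R y z -> congruence_gen R x z
| cong_mul x x' y y' : congruence_gen R x x' -> congruence_gen R y y' ->
    congruence_gen R (x * y) (x' * y').

Section QuotientMonoid.
Variables (M : monoidType) (R : M -> M -> Prop).

Definition congb : rel M := fun x y => `[< congruence_gen R x y >].

Lemma congb_refl : reflexive congb.
Proof. by move=> x; apply/asboolP; exact: cong_refl. Qed.

Lemma congb_sym : symmetric congb.
Proof. by move=> x y; apply/asboolP/asboolP; exact: cong_sym. Qed.

Lemma congb_trans : transitive congb.
Proof.
by move=> y x z /asboolP xy /asboolP yz; apply/asboolP; exact: cong_trans xy yz.
Qed.

Canonical congb_equiv := EquivRel congb congb_refl congb_sym congb_trans.

Definition quotient_monoid := {eq_quot congb_equiv}.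
HB.instance Definition _ := Choice.on quotient_monoid.

Definition quot_proj (x : M) : quotient_monoid := \pi_quotient_monoid x.

Lemma quot_projP x y : quot_proj x = quot_proj y <-> congruence_gen R x y.
Proof. by split=> [/eqmodP/asboolP|xy] //; apply/eqmodP/asboolP. Qed.

Definition quot_mul (u v : quotient_monoid) : quotient_monoid :=
  quot_proj (repr u * repr v).

Lemma quot_projK u : quot_proj (repr u) = u.
Proof. exact: reprK. Qed.

Lemma quot_mulE x y : quot_mul (quot_proj x) (quot_proj y) = quot_proj (x * y).
Proof. by apply/quot_projP/cong_mul; apply/quot_projP; exact: quot_projK. Qed.

Lemma quot_mulA : associative quot_mul.
Proof.
move=> u v w; rewrite -[u]quot_projK -[v]quot_projK -[w]quot_projK.
by rewrite !quot_mulE mulgA.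
Qed.

Lemma quot_mul1g : left_id (quot_proj 1) quot_mul.
Proof. by move=> u; rewrite -[u]quot_projK quot_mulE mul1g. Qed.

Lemma quot_mulg1 : right_id (quot_proj 1) quot_mul.
Proof. by move=> u; rewrite -[u]quot_projK quot_mulE mulg1. Qed.

HB.instance Definition _ :=
  isMonoid.Build quotient_monoid quot_mulA quot_mul1g quot_mulg1.

End QuotientMonoid.

Section FreeMonoid.
Variable T : choiceType.

Definition free_monoid := seq T.
HB.instance Definition _ := Choice.on free_monoid.
HB.instance Definition _ :=
  isMonoid.Build free_monoid (@catA T) (@cat0s T) (@cats0 T).

End FreeMonoid.

Section FreeProduct.
Variables (W : choiceType) (S : W -> monoidType).

Definition letter (w : W) (x : S w) : free_monoid {w : W & S w} :=
  [:: Tagged (fun w => S w) x].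

Inductive free_product_rel :
    free_monoid {w : W & S w} -> free_monoid {w : W & S w} -> Prop :=
| free_product_one w : free_product_rel (letter (1 : S w)) 1
| free_product_mul w (x y : S w) :
    free_product_rel (letter x * letter y) (letter (x * y)).

Definition free_product : monoidType := quotient_monoid free_product_rel.

Definition free_product_in (w : W) (x : S w) : free_product :=
  quot_proj free_product_rel (letter x).

End FreeProduct.

Section GraphProduct.
Variables (G : graph) (S : G -> monoidType).

Inductive graph_product_rel : free_product S -> free_product S -> Prop :=
| graph_product_comm v w (s : S v) (t : S w) : edge v w ->
    graph_product_rel (free_product_in s * free_product_in t)
                      (free_product_in t * free_product_in s).

Definition graph_product : monoidType := quotient_monoid graph_product_rel.

Definition graph_product_in (w : G) (x : S w) : graph_product :=
  quot_proj graph_product_rel (free_product_in x).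

End GraphProduct.

Definition subgraph_product (G : graph) (S : G -> monoidType) (A : set G) :
    monoidType :=
  @graph_product (full_subgraph A) (fun w => S (val w)).

Definition subgraph_product_in (G : graph) (S : G -> monoidType) (A : set G)
    (w : A) (x : S (val w)) : subgraph_product S A :=
  @graph_product_in (full_subgraph A) (fun w => S (val w)) w x.

Section DirectSum.
Variables (J : choiceType) (M : J -> monoidType).

Definition finitely_supported : set (forall j, M j) :=
  [set f | finite_set [set j | f j <> 1]].

Definition direct_sum := set_type finitely_supported.
HB.instance Definition _ := Choice.on direct_sum.

Lemma direct_sum_one_subproof : finitely_supported (fun j => 1).
Proof.
rewrite /finitely_supported /=.
by rewrite (_ : [set _ | _] = set0) // -subset0 => j /=.
Qed.

Lemma direct_sum_mul_subproof (f g : direct_sum) :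
  finitely_supported (fun j => val f j * val g j).
Proof.
have /set_mem ff := valP f; have /set_mem fg := valP g.
have ffg : finite_set ([set j | val f j <> 1] `|` [set j | val g j <> 1]).
  by rewrite finite_setU.
apply: sub_finite_set ffg => j /=; apply: contra_notP => /not_orP.
by move=> [/contrapT -> /contrapT ->]; rewrite mulg1.
Qed.

Definition direct_sum_one : direct_sum :=
  exist (fun f => f \in finitely_supported) _ (mem_set direct_sum_one_subproof).

Definition direct_sum_mul (f g : direct_sum) : direct_sum :=
  exist (fun h => h \in finitely_supported) _ (mem_set (direct_sum_mul_subproof f g)).

Lemma direct_sum_mulA : associative direct_sum_mul.
Proof.
by move=> f g h; apply/val_inj/functional_extensionality_dep => j; exact: mulgA.
Qed.

Lemma direct_sum_mul1g : left_id direct_sum_one direct_sum_mul.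
Proof.
by move=> f; apply/val_inj/functional_extensionality_dep => j; exact: mul1g.
Qed.

Lemma direct_sum_mulg1 : right_id direct_sum_one direct_sum_mul.
Proof.
by move=> f; apply/val_inj/functional_extensionality_dep => j; exact: mulg1.
Qed.

HB.instance Definition _ :=
  isMonoid.Build direct_sum direct_sum_mulA direct_sum_mul1g direct_sum_mulg1.

End DirectSum.

Definition irr_block (J : choiceType) (M : J -> monoidType) (j : J) :
    set (direct_sum M) :=
  [set f | noncore_irr (M j) (val f j) /\ forall j', j' <> j -> core (val f j')].

(* Main.v *)
Require Import Defs.
From mathcomp Require Import all_boot.
From mathcomp Require Import boolp classical_sets functions cardinality.
From Stdlib Require Import Relation_Operators.
From mathcomp Require Import finmap multiset.

(** The coconnected components of the graph commute with each other, so the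
    graph product is the restricted direct sum of the graph products over them.
    In a direct sum, meeting, core equivalence, least common multiples and being
    core are componentwise, hence an irreducible is supported in one summand up
    to core elements, and elements supported in different summands meet: the
    core graph of the sum is the join of the core graphs of the summands.

    All of this takes place in right LCM monoids, and graph products of right
    LCM monoids are right LCM: with reduced words up to shuffling as normal
    forms, every element g has a well-defined S_w-part, the multiples of y in
    S_w are the elements whose S_w-part is a multiple of y, and left
    multiplication by s changes S_w-parts in a controlled way.

    For a single right LCM monoid with a generalized scale N, counting classes
    shows that products of representatives of levels represent the product
    level. Hence the irreducibles are the elements whose level is irreducible in
    the image of N, two of them with different levels have an lcm of the product
    level, and the components are the levels of irreducibles, level n having n
    vertices. Conversely, balanced factorization moves an irreducible through a
    product of irreducibles, so the components of the factors (with
    multiplicity) depend only on the product; weighting each component by its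
    number of vertices gives N. *)

Set Implicit Arguments.
Unset Strict Implicit.
Unset Printing Implicit Defensive.

Local Open Scope classical_set_scope.
Local Open Scope group_scope.

(** * Right LCM monoids *)

Section RightLCMTheory.
Variable M : monoidType.
Implicit Types s t r x y a b c : M.

Lemma rmeetsE s t : rmeets s t <-> exists x y, s * x = t * y.
Proof.
split=> [[_ [[x _ <-] [y _ e]]]|[x [y e]]]; first by exists x, y.
by exists (s * x); split; [exists x | exists y].
Qed.

Lemma rmeets_sym s t : rmeets s t -> rmeets t s.
Proof. by rewrite /rmeets setIC. Qed.

Lemma rmeets_refl s : rmeets s s.
Proof. by apply/rmeetsE; exists 1, 1. Qed.

Lemma core1 : core (1 : M).
Proof. by move=> s; apply/rmeetsE; exists s, 1; rewrite mul1g mulg1. Qed.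

Lemma core_mul a b : core a -> core b -> core (a * b).
Proof.
move=> ca cb s; have /rmeetsE[x [y axy]] := ca s.
have /rmeetsE[p [q bpq]] := cb x.
by apply/rmeetsE; exists p, (y * q); rewrite -mulgA bpq !mulgA axy.
Qed.

Lemma core_mul_left a b : core (a * b) -> core a.
Proof.
move=> cab s; have /rmeetsE[x [y e]] := cab s.
by apply/rmeetsE; exists (b * x), y; rewrite mulgA.
Qed.

(** A least common right multiple recorded by its two cofactors: the solutions of [s * p = t * q]
    are exactly the right multiples of [(x, y)]. Intersections of ideals are handled in this form
    because cofactors compose. *)
Definition lcm_pair s t x y : Prop :=
  s * x = t * y /\
  forall p q, s * p = t * q -> exists z, p = x * z /\ q = y * z.

Lemma lcm_pair_sym s t x y : lcm_pair s t x y -> lcm_pair t s y x.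
Proof. by case=> e u; split=> // p q /esym /u [z []]; exists z. Qed.

Lemma lcm_pair_rideal s t x y :
  lcm_pair s t x y -> rideal s `&` rideal t = rideal (s * x).
Proof.
case=> e u; apply/seteqP; split=> [_ [[p _ <-] [q _ /esym]]|_ [z _ <-]].
  by move=> /u [z [-> _]]; exists z => //; rewrite mulgA.
by split; [exists (x * z) | exists (y * z)]; rewrite // mulgA // e.
Qed.

(** Cofactors compose: first [s] is passed through [t], then the resulting cofactor [y] through
    [t']. This drives the inductions over products of letters or of irreducibles. *)
Lemma lcm_pair_mul s t t' x y x' y' :
  lcm_pair s t x y -> lcm_pair y t' x' y' -> lcm_pair s (t * t') (x * x') y'.
Proof.
move=> [e u] [e' u']; split=> [|p q epq].
  by rewrite mulgA e -!mulgA e'.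
have [|z [-> zq]] := u p (t' * q); first by rewrite mulgA.
have [|z' [-> ->]] := u' z q; first by rewrite -zq.
by exists z'; rewrite mulgA.
Qed.

Lemma lcm_pair1 s : lcm_pair s 1 1 s.
Proof.
split=> [|p q e]; first by rewrite mulg1 mul1g.
by exists p; rewrite mul1g e mul1g.
Qed.

Definition left_cancellative := forall s t r, s * t = s * r -> t = r.

Lemma right_LCM_of_lcm_pair : left_cancellative ->
  (forall s t, rmeets s t -> exists x y, lcm_pair s t x y) -> right_LCM M.
Proof.
move=> canc ex; split=> // s t.
have [st|nst] := pselect (rmeets s t); last first.
  by left; apply/seteqP; split=> // r rst; apply: nst; exists r.
by right; have [x [y /lcm_pair_rideal ->]] := ex _ _ st; exists (s * x).
Qed.

Hypothesis M_LCM : right_LCM M.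

Lemma lcm_cancel : left_cancellative.
Proof. by case: M_LCM. Qed.

Lemma rmeets_lcm s t : rmeets s t -> exists x y, lcm_pair s t x y.
Proof.
move=> [w wst]; case: M_LCM => canc /(_ s t) [e|[r e]].
  by move: wst; rewrite e.
have [[x _ sx] [y _ ty]] : (rideal s `&` rideal t) r.
  by rewrite e; exists 1 => //; rewrite mulg1.
exists x, y; split=> [|p q epq]; first by rewrite sx.
have [z _ ez] : rideal r (s * p).
  by rewrite -e; split; [exists p | rewrite epq; exists q].
exists z; split; [apply: (canc s) | apply: (canc t)]; first by rewrite mulgA sx.
by rewrite mulgA ty -epq.
Qed.

Lemma rideal_lcm_pair s t x y :
  rideal s `&` rideal t = rideal (s * x) -> s * x = t * y -> lcm_pair s t x y.
Proof.
move=> e exy; split=> // p q epq.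
have [z _ ez] : rideal (s * x) (s * p).
  by rewrite -e; split; [exists p | rewrite epq; exists q].
exists z; split; [apply: (@lcm_cancel s) | apply: (@lcm_cancel t)].
  by rewrite mulgA.
by rewrite mulgA -exy -epq.
Qed.

Lemma core_mul_right a b : core (a * b) -> core b.
Proof.
move=> cab s; have /rmeetsE[x [y e]] := cab (a * s).
by apply/rmeetsE; exists x, y; apply: (@lcm_cancel a); rewrite !mulgA.
Qed.

(** Since [c] meets [t * s] for every [s], minimality of the lcm turns this into a meeting of [y]
    and [s]. *)
Lemma core_lcm c t x y : core c -> lcm_pair c t x y -> core y.
Proof.
move=> cc [e u] s; have /rmeetsE[p [q epq]] := cc (t * s).
have [z [_ ez]] : exists z, p = x * z /\ s * q = y * z.
  by apply: u; rewrite mulgA.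
by apply/rmeetsE; exists z, q.
Qed.

Lemma core_lcm_ex c t : core c -> exists x y, lcm_pair c t x y /\ core y.
Proof.
move=> cc; have [x [y u]] := rmeets_lcm (cc t).
by exists x, y; split=> //; apply: core_lcm u.
Qed.

Lemma core_pull c t : core c -> exists t' c', core c' /\ c * t' = t * c'.
Proof.
by move=> cc; have [x [y [[e _] cy]]] := core_lcm_ex t cc; exists x, y.
Qed.

(** The Ore condition inside the core, which is what makes [core_eq] transitive. *)
Lemma core_ore a b : core a -> core b ->
  exists a' b', [/\ core a', core b' & a * b' = b * a'].
Proof.
move=> ca cb; have [x [y [u cy]]] := core_lcm_ex b ca.
exists y, x; split=> //; last by case: u.
by apply: core_lcm (lcm_pair_sym u).
Qed.

Lemma core_eq_refl s : core_eq s s.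
Proof. by exists 1, 1; split=> //; exact: core1. Qed.

Lemma core_eq_sym s t : core_eq s t -> core_eq t s.
Proof. by move=> [a [b [? ? e]]]; exists b, a. Qed.

Lemma core_eq_trans t s r : core_eq s t -> core_eq t r -> core_eq s r.
Proof.
move=> [a [b [ca cb e]]] [c [d [cc cd e']]].
have [b' [c' [cb' cc' bc]]] := core_ore cb cc.
exists (a * c'), (d * b'); split; try exact: core_mul.
by rewrite !mulgA e -e' -!mulgA bc.
Qed.

Lemma core_eq_mull r s t : core_eq s t -> core_eq (r * s) (r * t).
Proof.
by move=> [a [b [ca cb e]]]; exists a, b; split=> //; rewrite -!mulgA e.
Qed.

Lemma core_eq_cancel r s t : core_eq (r * s) (r * t) -> core_eq s t.
Proof.
move=> [a [b [ca cb e]]]; exists a, b; split=> //.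
by apply: (@lcm_cancel r); rewrite !mulgA.
Qed.

Lemma core_eq_mulr s a : core a -> core_eq (s * a) s.
Proof.
by move=> ca; exists 1, a; split=> //; [exact: core1 | rewrite mulg1].
Qed.

Lemma core_core_eq s t : core_eq s t -> core s -> core t.
Proof.
move=> [a [b [ca cb e]]] cs; apply: (@core_mul_left t b).
by rewrite -e; exact: core_mul.
Qed.

Lemma core_eq1 s : core_eq s 1 <-> core s.
Proof.
split=> [/core_eq_sym /core_core_eq/(_ core1)//|cs].
by rewrite -[s]mul1g; exact: core_eq_mulr.
Qed.

(** The core factor [a] is pulled past the cofactor [x], so meeting depends on core classes only. *)
Lemma core_eq_rmeets s s' t : core_eq s s' -> rmeets s t -> rmeets s' t.
Proof.
move=> [a [b [ca cb e]]] /rmeetsE[x [y exy]].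
have [x' [a' [_ ax]]] := core_pull x ca.
apply/rmeetsE; exists (b * x'), (y * a').
by rewrite !mulgA -e -exy -!mulgA ax.
Qed.

Lemma core_eq_rmeets2 s s' t t' :
  core_eq s s' -> core_eq t t' -> rmeets s t -> rmeets s' t'.
Proof.
by move=> es et /(core_eq_rmeets es)/rmeets_sym/(core_eq_rmeets et)/rmeets_sym.
Qed.

Lemma rmeets_cancel r s t : rmeets (r * s) (r * t) <-> rmeets s t.
Proof.
rewrite !rmeetsE; split=> -[x [y e]]; exists x, y.
  by apply: (@lcm_cancel r); rewrite !mulgA.
by rewrite -!mulgA e.
Qed.

Lemma core_class_eq s t : core_class s = core_class t <-> core_eq s t.
Proof.
split=> [e|st].
  have : core_class t t by exact: core_eq_refl.
  by rewrite -e.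
apply/seteqP; split=> r; apply: core_eq_trans => //; exact: core_eq_sym.
Qed.

Lemma core_act_class a s : core a ->
  core_act a (core_class s) = core_class (a * s).
Proof.
move=> ca; apply/seteqP; split=> [r [t st tr]|r asr].
  exact: core_eq_trans (core_eq_mull a st) tr.
by exists s => //; exact: core_eq_refl.
Qed.

Lemma noncore_irr_core_eq s t : core_eq s t -> noncore_irr M s ->
  noncore_irr M t.
Proof.
move=> [a [b [ca cb e]]] [ns is_]; split=> [ct|c p q cc tc].
  by apply: ns; apply: core_core_eq ct; exists b, a.
have [b' [c' [cb' cc' bc]]] := core_ore cb cc.
have eq1 : s * (a * c') = p * (q * b').
  by rewrite !mulgA e -tc -!mulgA bc.
have [|cp|cq] := is_ _ _ _ _ eq1; first exact: core_mul.
  by left.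
by right; exact: core_mul_left cq.
Qed.

Lemma noncore_irr_mulr s c : core c -> noncore_irr M s -> noncore_irr M (s * c).
Proof.
by move=> cc; apply: noncore_irr_core_eq; apply/core_eq_sym/core_eq_mulr.
Qed.

(** If [c * s * a = t * r], the lcm of [c] and [t], with cofactors [t'] and a core [c'], gives
    [s * a = t' * z] and [r = c' * z]; irreducibility of [s] decides between [t'] and [z]. *)
Lemma noncore_irr_mull c s : core c -> noncore_irr M s -> noncore_irr M (c * s).
Proof.
move=> cc [ns is_]; split=> [/core_mul_right //|a t r ca e].
have [t' [c' [[ect u] cc']]] := core_lcm_ex t cc.
have [|z [e1 e2]] := u (s * a) r; first by rewrite mulgA.
have [ct'|cz] := is_ _ _ _ ca e1.
  left; apply: (@core_mul_left t c'); rewrite -ect; exact: core_mul.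
by right; rewrite e2; exact: core_mul.
Qed.

Lemma noncore_irr_mull_inv c s :
  core c -> noncore_irr M (c * s) -> noncore_irr M s.
Proof.
move=> cc [ns is_]; split=> [cs|a t r ca e].
  by apply: ns; exact: core_mul.
have [||] := is_ a (c * t) r ca; first by rewrite -!mulgA e.
  by move/core_mul_right; left.
by right.
Qed.

End RightLCMTheory.

Definition set_elt (T : choiceType) (A : set T) x (h : A x) : A :=
  exist _ x (mem_set h).

Lemma set_eltP (T : choiceType) (A : set T) (x : A) : A (val x).
Proof. exact: set_mem (valP x). Qed.

(** * Components of the core graph *)

Section CoconnectedTheory.
Variable G : graph.
Implicit Types u v : G.

Lemma coconnected_sym u v : coconnected u v -> coconnected v u.
Proof.
elim=> [x y e|x|x y z _ xy _ yz]; last exact: rt_trans yz xy.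
  by apply: rt_step => /edge_sym.
exact: rt_refl.
Qed.

Lemma coconn_comp_eq u v : coconn_comp u = coconn_comp v <-> coconnected u v.
Proof.
split=> [e|uv].
  have : coconn_comp v v by exact: rt_refl.
  by rewrite -e.
apply/seteqP; split=> w; last exact: rt_trans.
exact/rt_trans/coconnected_sym.
Qed.

End CoconnectedTheory.

Section Index.
Variable M : monoidType.
Implicit Types s t a : M.

(* [irr_index], extended by the empty set to the elements that are not noncore
   irreducible. *)
Definition idx s : set (core_graph M) :=
  [set v | exists2 s' : noncore_irr M, val s' = s & irr_index s' v].

Lemma idx_val (s : noncore_irr M) : idx (val s) = irr_index s.
Proof.
by apply/seteqP; split=> [v [s' /val_inj ->]|v sv] //; exists s.
Qed.

Lemma idx_set_elt s (h : noncore_irr M s) : idx s = irr_index (set_elt h).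
Proof. exact: (idx_val (set_elt h)). Qed.

Lemma irr_classP (v : core_graph M) : exists s : noncore_irr M, v = irr_class s.
Proof.
have /set_mem[s hs e] := valP v.
by exists (set_elt hs); apply: val_inj.
Qed.

Lemma idx_comps s : noncore_irr M s -> coconn_comps (core_graph M) (idx s).
Proof. by move=> hs; rewrite (idx_set_elt hs); eexists. Qed.

Lemma idx0 s : ~ noncore_irr M s -> idx s = set0.
Proof.
by move=> ns; apply/seteqP; split=> // v [t ts _]; apply: ns; rewrite -ts;
  exact: set_eltP.
Qed.

(** The index of an irreducible contains its own vertex, whereas all other elements have empty
    index. *)
Lemma noncore_irr_idx s t : idx s = idx t -> noncore_irr M s -> noncore_irr M t.
Proof.
move=> st hs; apply: contrapT => /idx0 t0.
suff : idx s (irr_class (set_elt hs)) by rewrite st t0.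
by rewrite (idx_set_elt hs); exact: rt_refl.
Qed.

Lemma comps_idx C : coconn_comps (core_graph M) C ->
  exists2 s, noncore_irr M s & C = idx s.
Proof.
move=> [v _ <-]; have [s ->] := irr_classP v.
by exists (val s); [exact: set_eltP | rewrite idx_val].
Qed.

Hypothesis M_LCM : right_LCM M.

Lemma irr_class_eq (s t : noncore_irr M) :
  irr_class s = irr_class t <-> core_eq (val s) (val t).
Proof.
rewrite -core_class_eq //; split=> [/(congr1 val)//|e]; exact: val_inj.
Qed.

Lemma core_edgeE (s t : noncore_irr M) :
  core_edge (irr_class s) (irr_class t) <->
  ~ core_eq (val s) (val t) /\ rmeets (val s) (val t).
Proof.
rewrite -irr_class_eq; split=> [[st [s' [t' [es et m]]]]|[st m]]; split=> //.
  move/irr_class_eq/core_eq_sym: es => es.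
  move/irr_class_eq/core_eq_sym: et => et.
  exact (core_eq_rmeets2 M_LCM es et m).
by exists s, t.
Qed.

Lemma idx_close s t : noncore_irr M s -> noncore_irr M t ->
  core_eq s t \/ perp s t -> idx s = idx t.
Proof.
move=> hs ht st; rewrite (idx_set_elt hs) (idx_set_elt ht).
apply/coconn_comp_eq/rt_step; rewrite /= core_edgeE /= => -[].
by case: st.
Qed.

Lemma idx_core_eq s t : core_eq s t -> idx s = idx t.
Proof.
move=> st; have [hs|ns] := pselect (noncore_irr M s).
  by apply: idx_close => //; [exact: noncore_irr_core_eq st hs | left].
rewrite idx0 // idx0 // => ht; apply: ns.
by apply: noncore_irr_core_eq ht => //; exact: core_eq_sym.
Qed.

(** Non-edges of the core graph join precisely the irreducibles that are core equivalent or
    orthogonal, so this is induction along a path in the complementary graph. *)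
Lemma idx_invariant (T : Type) (F : M -> T) :
  (forall s t, noncore_irr M s -> noncore_irr M t ->
     core_eq s t \/ perp s t -> F s = F t) ->
  forall s t, noncore_irr M s -> noncore_irr M t -> idx s = idx t -> F s = F t.
Proof.
move=> FE s t hs ht.
rewrite (idx_set_elt hs) (idx_set_elt ht) => /coconn_comp_eq st.
suff : forall u v : core_graph M, coconnected u v ->
    forall s t : noncore_irr M, u = irr_class s -> v = irr_class t ->
    F (val s) = F (val t).
  by move/(_ _ _ st (set_elt hs) (set_elt ht)); apply.
move=> {s t hs ht st} u v; elim=> [x y nxy|x|x y z _ IH1 _ IH2] s t.
- move=> xs yt; apply: FE; [exact: set_eltP|exact: set_eltP|].
  move: nxy; rewrite xs yt /= core_edgeE.
  by have [|nst] := pselect (core_eq (val s) (val t));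
    [left|right => m; exact: nxy].
- by move=> -> /irr_class_eq st; apply: FE; try exact: set_eltP; left.
- by move=> xs zt; have [r yr] := irr_classP y; rewrite (IH1 s r) // (IH2 r t).
Qed.

Lemma idx_mem (s t : noncore_irr M) :
  idx (val s) (irr_class t) <-> idx (val t) = idx (val s).
Proof.
rewrite !idx_val; split=> [st|e]; first exact/esym/coconn_comp_eq.
exact/coconn_comp_eq/esym.
Qed.

(** Replaces vertices by representatives, so that later arguments deal with elements of the monoid
    only; [balancedE] and [core_act_restrictsE] do the same for the other two conditions. *)
Lemma edge_free_componentsE : edge_free_components (core_graph M) <->
  forall s t, noncore_irr M s -> noncore_irr M t -> idx s = idx t ->
    rmeets s t -> core_eq s t.
Proof.
split=> [ef s t hs ht e m|ef [C hC] [u hu] [v hv]].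
  apply: contrapT => nst.
  pose s' := set_elt hs; pose t' := set_elt ht.
  pose C := set_elt (idx_comps hs).
  have us : val C (irr_class s') by apply/(idx_mem s' s').
  have vt : val C (irr_class t') by apply/(idx_mem s' t').
  refine (ef C (set_elt us) (set_elt vt) _).
  exact/(core_edgeE s' t').
rewrite /= /full_edge /=; move: hu hv => /set_mem hu /set_mem hv.
have [s hs CE] := comps_idx (set_mem hC); subst C.
have [p pE] := irr_classP u; have [q qE] := irr_classP v; subst u v.
move=> /core_edgeE[npq m]; apply: npq; apply: ef => //; try exact: set_eltP.
move: hu hv => /=.
by move=> /(idx_mem (set_elt hs))-> /(idx_mem (set_elt hs))->.
Qed.

Lemma balancedE : balanced_factorization M <->
  forall s t, noncore_irr M s -> noncore_irr M t -> idx s <> idx t ->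
  exists s' t', [/\ noncore_irr M s', noncore_irr M t', lcm_pair s t t' s',
                    idx s' = idx s & idx t' = idx t].
Proof.
split=> [bal s t hs ht|bal s t].
  rewrite (idx_set_elt hs) (idx_set_elt ht) => /bal.
  move=> [s' [t' [/(rideal_lcm_pair M_LCM) u /u {}u]]].
  rewrite -!idx_val => es et.
  exists (val s'), (val t'); split=> //; try exact: set_eltP.
rewrite -!idx_val => /bal[||s' [t' [hs ht u es et]]]; try exact: set_eltP.
exists (set_elt hs), (set_elt ht).
rewrite -!idx_val (lcm_pair_rideal u); split=> //; by case: u.
Qed.

Lemma core_act_restrictsE : core_act_restricts M <->
  forall a s, core a -> noncore_irr M s -> idx (a * s) = idx s.
Proof.
split=> [res a s ca hs|res [C hC] a ca v Cv].
  pose C := set_elt (idx_comps hs).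
  have has := noncore_irr_mull M_LCM ca hs.
  have /(res C a ca)[w Cw we] : val C (irr_class (set_elt hs)).
    exact/(idx_mem (set_elt hs) (set_elt hs)).
  apply/(idx_mem (set_elt hs) (set_elt has)).
  suff -> : irr_class (set_elt has) = w by [].
  by apply: val_inj; rewrite we /= core_act_class.
have [s hs CE] := comps_idx (set_mem hC); subst C.
have [p pE] := irr_classP v; subst v.
have hp := set_eltP p.
have hap := noncore_irr_mull M_LCM ca hp.
exists (irr_class (set_elt hap)); last by rewrite /= core_act_class.
apply/(idx_mem (set_elt hs) (set_elt hap)) => /=.
by rewrite res //; exact/(idx_mem (set_elt hs)).
Qed.

(* Left multiplication by a core element permutes the components; if there are
   two of them, the lcm of s and t a exhibits a vertex that stays in its
   component. *)
Lemma balanced_core_act : balanced_factorization M -> core_act_restricts M.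
Proof.
move=> /balancedE bal; apply/core_act_restrictsE => a s ca hs.
have has r : noncore_irr M r -> noncore_irr M (a * r).
  exact: noncore_irr_mull.
have [[t ht st]|one] := pselect (exists2 t, noncore_irr M t & idx s <> idx t);
    last first.
  apply: contrapT => e; apply: one; exists (a * s); first exact: has.
  exact/nesym.
(* One irreducible that stays in the component suffices: multiplication by [a] preserves core
   equivalence and orthogonality, so the index of [a * r] is constant along the component. *)
suff [r [hr rs ar]] : exists r, [/\ noncore_irr M r, idx r = idx s &
    idx (a * r) = idx r].
  rewrite -[RHS]rs -ar; apply: (idx_invariant (F := fun r => idx (a * r)))
    => //.
  move=> p q hp hq [pq|pq]; apply: idx_close; try exact: has.
    by left; exact: core_eq_mull.
  by right; move/(rmeets_cancel M_LCM).
have [s1 [t1 [hs1 ht1 [e1 u1] is1 it1]]] := bal _ _ hs ht st.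
have hta := noncore_irr_mulr M_LCM ca ht.
have ita : idx (t * a) = idx t.
  by apply: idx_core_eq; exact: core_eq_mulr.
have [|s2 [t2 [hs2 ht2 [e2 _] is2 it2]]] := bal _ _ hs hta.
  by rewrite ita.
(* The multiple [s * t2 = t * (a * s2)] lies over the lcm of [s] and [t], so [a * s2 = s1 * z].
   Irreducibility of [a * s2] makes [z] core, hence [a * s2] and [s1] are core equivalent. *)
have [|z [_ z2]] := u1 t2 (a * s2); first by rewrite mulgA.
exists s2; split=> //; rewrite is2 -is1.
apply: idx_core_eq.
have [ns1 _] := hs1.
have [_ /(_ 1 s1 z)] := has _ hs2; rewrite mulg1 => /(_ (@core1 M) z2)[//|cz].
by rewrite z2; exact: core_eq_mulr.
Qed.

End Index.

(** * Normal forms in graph products *)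

Section ReducedWords.
Variables (G : graph) (S : G -> monoidType).
Notation lettr := {w : G & S w}.
Notation word := (seq lettr).
Implicit Types (v w : G) (a b : lettr) (l m : word).

Definition adj v w : bool := `[< edge v w >].

Lemma adj_sym v w : adj v w = adj w v.
Proof. by apply/asboolP/asboolP; exact: edge_sym. Qed.

Lemma adj_irr v : adj v v = false.
Proof. by apply/asboolP; exact: edge_irr. Qed.

Lemma adj_neq v w : adj v w -> (v == w) = false.
Proof. by apply: contraTF => /eqP ->; rewrite adj_irr. Qed.

Lemma adj_neq' v w : adj v w -> (w == v) = false.
Proof. by move=> /adj_neq; rewrite eq_sym. Qed.

(** A dependent cast to the vertex [w]; the default [1] is never reached in [front], which tests the
    tag first. *)
Definition letter_at w a : S w := tagged_as (Tagged S (1 : S w)) a.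

Lemma letter_atE w (x : S w) : letter_at w (Tagged S x) = x.
Proof. exact: (@tagged_asE _ _ (Tagged S (1 : S w)) x). Qed.

Lemma letter_atK w a : tag a = w -> Tagged S (letter_at w a) = a.
Proof. by case: a => v x /= <-; rewrite letter_atE. Qed.

(* The vertex-w syllable that can be shuffled to the front of l, and the word
   that remains when it is removed. *)
Fixpoint front w l : S w :=
  if l is a :: l' then
    if tag a == w then letter_at w a else
    if adj (tag a) w then front w l' else 1
  else 1.

Fixpoint behind w l : word :=
  if l is a :: l' then
    if tag a == w then l' else
    if adj (tag a) w then a :: behind w l' else l
  else [::].

(** The condition on [front] says that no later syllable can be shuffled next to [a] and merged with
    it. *)
Fixpoint reduced l : Prop :=
  if l is a :: l' then
    [/\ tagged a <> 1, front (tag a) l' = 1 & reduced l']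
  else True.

Inductive shuffle : word -> word -> Prop :=
| shuffle_refl l : shuffle l l
| shuffle_cons a l l' : shuffle l l' -> shuffle (a :: l) (a :: l')
| shuffle_swap a b l :
    adj (tag a) (tag b) -> shuffle (a :: b :: l) (b :: a :: l)
| shuffle_trans m l l' : shuffle l m -> shuffle m l' -> shuffle l l'.

(** Left multiplication of a reduced word by a letter: [x] is merged with the syllable that can be
    shuffled to the front, and a trivial result is dropped. *)
Definition push v (x : S v) l : word :=
  let y := x * front v l in
  if y == 1 then behind v l else Tagged S y :: behind v l.

Lemma shuffle_sym l l' : shuffle l l' -> shuffle l' l.
Proof.
elim=> {l l'} [l|a l l' _ IH|a b l ab|m l l' _ IH1 _ IH2].
- exact: shuffle_refl.
- exact: shuffle_cons.
- by apply: shuffle_swap; rewrite adj_sym.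
- exact: shuffle_trans IH2 IH1.
Qed.

Lemma shuffle_front w l l' : shuffle l l' -> front w l = front w l'.
Proof.
elim=> {l l'} [//|a l l' _ IH|a b l ab|m l l' _ -> _ ->] //=.
  by rewrite IH.
case: (eqVneq (tag a) w) => [e|ne]; first by rewrite -e (adj_neq' ab) adj_sym
  ab.
case: (eqVneq (tag b) w) => [e|ne']; first by rewrite -e ab.
by case: (adj (tag a) w); case: (adj (tag b) w).
Qed.

Lemma shuffle_behind w l l' :
  shuffle l l' -> shuffle (behind w l) (behind w l').
Proof.
elim=> {l l'} [l|a l l' ll' IH|a b l ab|m l l' _ IH1 _ IH2] /=.
- exact: shuffle_refl.
- by case: eqP => // _; case: adj; exact: shuffle_cons.
- case: (eqVneq (tag a) w) => [e|ne].
    rewrite -e (adj_neq' ab) adj_sym ab; exact: shuffle_refl.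
  case: (eqVneq (tag b) w) => [e|ne'].
    rewrite -e ab; exact: shuffle_refl.
  by case: (adj (tag a) w); case: (adj (tag b) w); exact: shuffle_swap.
- exact: shuffle_trans IH1 IH2.
Qed.

Lemma shuffle_size l l' : shuffle l l' -> size l = size l'.
Proof. by elim=> {l l'} //= [a l l' _ ->|m l l' _ ->]. Qed.

Lemma front_behind w l : reduced l -> front w (behind w l) = 1.
Proof.
elim: l => //= a l IH [na fa rl]; case: (eqVneq (tag a) w) => [<-//|ne].
by case aw: (adj (tag a) w) => /=; rewrite (negPf ne) aw // IH.
Qed.

Lemma front_behind_adj v w l : adj v w -> front v (behind w l) = front v l.
Proof.
move=> vw; elim: l => //= a l IH; case: (eqVneq (tag a) w) => [->|ne].
  by rewrite (adj_neq' vw) adj_sym vw.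
by case aw: (adj (tag a) w) => //=; rewrite IH.
Qed.

Lemma behind_comm v w l :
  adj v w -> behind v (behind w l) = behind w (behind v l).
Proof.
move=> vw; elim: l => //= a l IH; case: (eqVneq (tag a) w) => [e|ne].
  by rewrite e (adj_neq' vw) adj_sym vw /= e eqxx.
case: (eqVneq (tag a) v) => [e|ne'].
  by rewrite e vw /= e eqxx.
case aw: (adj (tag a) w); case av: (adj (tag a) v) => /=;
  by rewrite ?(negPf ne) ?(negPf ne') ?aw ?av ?IH.
Qed.

Lemma reduced_behind w l : reduced l -> reduced (behind w l).
Proof.
elim: l => //= a l IH [na fa rl]; case: (eqVneq (tag a) w) => [//|ne].
case aw: (adj (tag a) w) => //=; split=> //; last exact: IH.
by rewrite front_behind_adj.
Qed.

Lemma behind_id w l : reduced l -> front w l = 1 -> behind w l = l.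
Proof.
elim: l => //= a l IH [na fa rl]; case: (eqVneq (tag a) w) => [e|ne].
  by case: a na {fa} e => v x /= nx e; subst w; rewrite letter_atE.
by case: ifP => // _ /(IH rl) ->.
Qed.

Lemma shuffle_to_front w l : reduced l -> front w l <> 1 ->
  shuffle l (Tagged S (front w l) :: behind w l).
Proof.
elim: l => //= a l IH [na fa rl]; case: (eqVneq (tag a) w) => [e|ne].
  by rewrite letter_atK // => _; exact: shuffle_refl.
case: ifP => // aw /(IH rl) sh.
apply: shuffle_trans (shuffle_cons a sh) _.
exact: shuffle_swap.
Qed.

Lemma size_behind w l : size (behind w l) <= size l.
Proof.
elim: l => //= a l IH; case: eqP => // _.
by case: ifP.
Qed.

Lemma push_reduced v (x : S v) l : reduced l -> reduced (push x l).
Proof.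
move=> rl; rewrite /push; case: eqP => [_|ne] /=; first exact: reduced_behind.
by split=> //; [exact: front_behind | exact: reduced_behind].
Qed.

Lemma push_shuffle v (x : S v) l l' :
  shuffle l l' -> shuffle (push x l) (push x l').
Proof.
move=> ll'; rewrite /push (shuffle_front _ ll').
by case: eqP => _; [|apply: shuffle_cons]; exact: shuffle_behind.
Qed.

Lemma front_push v (x : S v) l : reduced l ->
  front v (push x l) = x * front v l.
Proof.
move=> rl; rewrite /push; case: eqP => [->|ne] /=; first exact: front_behind.
by rewrite eqxx letter_atE.
Qed.

Lemma behind_push v (x : S v) l : reduced l -> behind v (push x l) = behind v l.
Proof.
move=> rl; rewrite /push; case: eqP => [_|ne] /=; last by rewrite eqxx.
by rewrite behind_id //; [exact: reduced_behind | exact: front_behind].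
Qed.

Lemma front_push_adj v w (x : S v) l :
  adj v w -> front w (push x l) = front w l.
Proof.
move=> vw; have wv : adj w v by rewrite adj_sym.
rewrite /push; case: eqP => _ /=; rewrite ?(adj_neq vw) ?vw;
  exact: front_behind_adj.
Qed.

Lemma behind_push_adj v w (x : S v) l :
  adj v w -> behind w (push x l) = push x (behind w l).
Proof.
move=> vw; rewrite /push front_behind_adj // behind_comm //.
by case: eqP => _ //=; rewrite (adj_neq vw) vw.
Qed.

(** The syllable left at [v] is nontrivial and cannot be shuffled past a syllable at [w], so it
    hides everything behind it. *)
Lemma front_push_nadj v w (x : S v) l : v != w -> ~~ adj v w ->
  x * front v l <> 1 -> front w (push x l) = 1.
Proof.
move=> ne nadj; rewrite /push; case: eqP => // _ _ /=.
by rewrite (negPf ne) (negPf nadj).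
Qed.

(** Together with [push_one] and [push_comm], this verifies the defining relations of the graph
    product for [push] up to shuffling. Hence the graph product acts on shuffle classes of reduced
    words, as in van der Waerden's argument for normal forms. *)
Lemma push_mul v (x y : S v) l : reduced l ->
  push x (push y l) = push (x * y) l.
Proof.
by move=> rl; rewrite {1}/push front_push // behind_push // mulgA.
Qed.

Lemma push_one v l : reduced l -> shuffle (push (1 : S v) l) l.
Proof.
move=> rl; rewrite /push mul1g; case: eqP => [e|ne].
  by rewrite behind_id //; exact: shuffle_refl.
exact/shuffle_sym/shuffle_to_front.
Qed.

Lemma push_comm v w (x : S v) (y : S w) l : adj v w ->
  shuffle (push x (push y l)) (push y (push x l)).
Proof.
move=> vw; have wv : adj w v by rewrite adj_sym.
have push2 u1 u2 (z1 : S u1) (z2 : S u2) : adj u2 u1 ->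
    push z1 (push z2 l) = if z1 * front u1 l == 1 then push z2 (behind u1 l)
      else Tagged S (z1 * front u1 l) :: push z2 (behind u1 l).
  by move=> u21; rewrite {1}/push front_push_adj // behind_push_adj.
rewrite !push2 // /push !front_behind_adj // (behind_comm _ vw).
case: eqP => _; case: eqP => _; try exact: shuffle_refl.
exact: shuffle_swap.
Qed.

Definition normalize l m : word := foldr (fun a => push (tagged a)) m l.

Lemma normalize_cat l l' m :
  normalize (l ++ l') m = normalize l (normalize l' m).
Proof. exact: foldr_cat. Qed.

Lemma normalize_reduced l m : reduced m -> reduced (normalize l m).
Proof. by move=> rm; elim: l => //= a l; exact: push_reduced. Qed.

Lemma normalize_shuffle l m m' :
  shuffle m m' -> shuffle (normalize l m) (normalize l m').
Proof. by move=> mm'; elim: l => //= a l; exact: push_shuffle. Qed.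

Lemma normalize_free_product l l' m :
  congruence_gen (@free_product_rel G S) l l' -> reduced m ->
  shuffle (normalize l m) (normalize l' m).
Proof.
move=> ll'; elim: ll' m => {l l'} /= [l l' []|l|l l' _ IH|l1 l l2 _ IH1 _ IH2|].
- by move=> w m rm; exact: push_one.
- by move=> w x y m rm; rewrite /= push_mul //; exact: shuffle_refl.
- by move=> m _; exact: shuffle_refl.
- by move=> m rm; exact/shuffle_sym/IH.
- by move=> m rm; apply: shuffle_trans (IH1 _ rm) (IH2 _ rm).
- move=> l1 l1' l2 l2' _ IH1 _ IH2 m rm; rewrite !normalize_cat.
  apply: shuffle_trans (normalize_shuffle _ (IH2 _ rm)) (IH1 _ _).
  exact: normalize_reduced.
Qed.

Lemma normalize_repr_mul (p q : free_product S) m : reduced m ->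
  shuffle (normalize (repr (p * q)) m)
    (normalize (repr p) (normalize (repr q) m)).
Proof.
move=> rm; rewrite -normalize_cat; apply: normalize_free_product => //.
by apply/quot_projP; rewrite quot_projK.
Qed.

Lemma normalize_repr_in v (x : S v) m : reduced m ->
  shuffle (normalize (repr (free_product_in x)) m) (push x m).
Proof.
move=> rm; apply: (@normalize_free_product _ (letter x)) => //.
by apply/quot_projP; rewrite quot_projK.
Qed.

Lemma normalize_repr_in_mul v (x : S v) p m : reduced m ->
  shuffle (normalize (repr (free_product_in x * p)) m)
          (push x (normalize (repr p) m)).
Proof.
move=> rm; apply: shuffle_trans (normalize_repr_mul _ _ rm) _.
by apply: normalize_repr_in; exact: normalize_reduced.
Qed.

(** The words [repr p] and [repr q] are arbitrary representatives, but by [normalize_free_product]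
    their choice matters only up to shuffling; only the commutation relation remains to be
    checked. *)
Lemma normalize_graph_product (p q : free_product S) m :
  congruence_gen (@graph_product_rel G S) p q -> reduced m ->
  shuffle (normalize (repr p) m) (normalize (repr q) m).
Proof.
move=> pq; elim: pq m => {p q} [p q []|p|p q _ IH|p q r _ IH1 _ IH2|].
- move=> v w x y vw m rm.
  have rin u (z : S u) := push_reduced z rm.
  apply: shuffle_trans (normalize_repr_in_mul _ _ rm) _.
  apply: shuffle_trans (push_shuffle _ (normalize_repr_in _ rm)) _.
  apply: shuffle_sym.
  apply: shuffle_trans (normalize_repr_in_mul _ _ rm) _.
  apply: shuffle_trans (push_shuffle _ (normalize_repr_in _ rm)) _.
  by apply: push_comm; rewrite adj_sym; apply/asboolP.
- by move=> m _; exact: shuffle_refl.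
- by move=> m rm; exact/shuffle_sym/IH.
- by move=> m rm; apply: shuffle_trans (IH1 _ rm) (IH2 _ rm).
- move=> p p' q q' _ IH1 _ IH2 m rm.
  apply: shuffle_trans (normalize_repr_mul _ _ rm) _.
  apply: shuffle_trans (shuffle_sym (normalize_repr_mul _ _ rm)).
  apply: shuffle_trans (normalize_shuffle _ (IH2 _ rm)) (IH1 _ _).
  exact: normalize_reduced.
Qed.

End ReducedWords.

(** * Vertex parts of elements of a graph product *)

Section GraphProductTheory.
Variables (G : graph) (S : G -> monoidType).
Notation P := (graph_product S).
Notation word := (seq {w : G & S w}).
Notation "''in' x" := (graph_product_in x) (at level 8).
Implicit Types (g h : P) (l : word) (v w : G).

Lemma quot_proj_mul (M : monoidType) (R : M -> M -> Prop) (x y : M) :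
  quot_proj R (x * y) = quot_proj R x * quot_proj R y.
Proof. by rewrite -[LHS]quot_mulE. Qed.

Lemma graph_product_in1 w : 'in (1 : S w) = 1 :> P.
Proof.
congr (quot_proj _ _); apply/quot_projP/cong_base; exact: free_product_one.
Qed.

Lemma graph_product_in_mul w (x y : S w) : 'in (x * y) = 'in x * 'in y :> P.
Proof.
rewrite /graph_product_in -quot_proj_mul; congr (quot_proj _ _).
rewrite /free_product_in -quot_proj_mul.
apply/quot_projP/cong_sym/cong_base; exact: free_product_mul.
Qed.

Lemma graph_product_in_comm v w (x : S v) (y : S w) :
  edge v w -> 'in x * 'in y = 'in y * 'in x :> P.
Proof.
move=> vw; rewrite -[LHS]quot_proj_mul -[RHS]quot_proj_mul.
by apply/quot_projP/cong_base; apply: graph_product_comm.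
Qed.

Definition word_val l : P := \big[*%g/1]_(a <- l) 'in (tagged a).

Lemma word_val_cons v (x : S v) l :
  word_val (Tagged S x :: l) = 'in x * word_val l.
Proof. by rewrite /word_val big_cons. Qed.

Lemma word_val_consE a l : word_val (a :: l) = 'in (tagged a) * word_val l.
Proof. by rewrite /word_val big_cons. Qed.

Lemma word_val_repr g : word_val (repr (repr g)) = g.
Proof.
rewrite -[RHS]quot_projK -[X in _ = quot_proj _ X]quot_projK.
elim: (repr (repr g)) => [|a l IH]; first by rewrite /word_val big_nil.
rewrite word_val_consE IH.
have -> : a :: l = letter (tagged a) * l by case: a.
by rewrite [X in _ = quot_proj _ X]quot_proj_mul quot_proj_mul.
Qed.

Lemma graph_product_ind (Q : P -> Prop) :
  Q 1 -> (forall w (x : S w) g, Q g -> Q ('in x * g)) -> forall g, Q g.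
Proof.
move=> Q1 QM g; rewrite -(word_val_repr g).
elim: (repr (repr g)) => [|a l IH]; first by rewrite /word_val big_nil.
by rewrite word_val_consE; exact: QM.
Qed.

(** The two [repr] lead from the graph product to the free product and on to words. The result is
    canonical up to shuffling, under which [front], [size] and [word_val] are invariant. *)
Definition normal g : word := normalize (repr (repr g)) [::].

Lemma normal_reduced g : reduced (normal g).
Proof. exact: normalize_reduced. Qed.

Lemma shuffle_word_val l l' : shuffle l l' -> word_val l = word_val l'.
Proof.
elim=> {l l'} [//|a l l' _ IH|a b l ab|m l l' _ -> _ ->] //.
  by rewrite !word_val_consE IH.
rewrite !word_val_consE !mulgA; congr (_ * _).
by apply: graph_product_in_comm; exact/asboolP.
Qed.

Lemma word_val_front w l : reduced l ->
  word_val l = 'in (front w l) * word_val (behind w l).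
Proof.
move=> rl; have [e|ne] := pselect (front w l = 1).
  by rewrite e graph_product_in1 mul1g behind_id.
by rewrite -word_val_cons; apply: shuffle_word_val; exact: shuffle_to_front.
Qed.

Lemma word_val_push w (x : S w) l : reduced l ->
  word_val (push x l) = 'in x * word_val l.
Proof.
move=> rl; rewrite (@word_val_front w l) // mulgA -graph_product_in_mul /push.
case: eqP => [->|_]; last exact: word_val_cons.
by rewrite graph_product_in1 mul1g.
Qed.

Lemma word_val_normal g : word_val (normal g) = g.
Proof.
rewrite -[RHS]word_val_repr /normal.
elim: (repr (repr g)) => //= a l IH.
rewrite word_val_push; last exact: normalize_reduced.
by rewrite IH word_val_consE.
Qed.

Lemma normal_mul v (x : S v) g : shuffle (normal ('in x * g))
  (push x (normal g)).
Proof.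
rewrite /normal.
have r0 : reduced ([::] : word) by [].
apply: shuffle_trans (normalize_repr_in_mul _ _ r0).
apply: normalize_graph_product => //; apply/quot_projP.
by rewrite quot_projK quot_proj_mul quot_projK.
Qed.

(** Needed for the induction on length in [vhead_dichotomy], where a word is replaced by a piece of
    the normal form of its value. *)
Lemma size_normal_word_val l : size (normal (word_val l)) <= size l.
Proof.
elim: l => [|a l IH].
  have r0 : reduced ([::] : word) by [].
  suff /shuffle_size : shuffle (normal (word_val [::])) [::] by move=> /= ->.
  rewrite /word_val big_nil /normal.
  apply: (@shuffle_trans _ _ (normalize (repr (1 : free_product S)) [::])).
    apply: normalize_graph_product => //.
    by apply/quot_projP; rewrite quot_projK.
  apply: (@normalize_free_product _ _ _ [::]) => //.
  by apply/quot_projP; rewrite quot_projK.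
rewrite word_val_consE (shuffle_size (normal_mul _ _)) /= /push.
have le := leq_trans (size_behind (tag a) (normal (word_val l))) IH.
by case: eqP => _ //=; exact: leqW.
Qed.

Definition vhead w g : S w := front w (normal g).
Definition vrest w g : P := word_val (behind w (normal g)).

Lemma vhead_vrest w g : g = 'in (vhead w g) * vrest w g.
Proof.
by rewrite -word_val_front ?word_val_normal //; exact: normal_reduced.
Qed.

Lemma vhead_mul w (x : S w) g : vhead w ('in x * g) = x * vhead w g.
Proof.
by rewrite /vhead (shuffle_front _ (normal_mul _ _)) front_push //;
  exact: normal_reduced.
Qed.

Lemma vrest_mul w (x : S w) g : vrest w ('in x * g) = vrest w g.
Proof.
rewrite /vrest (shuffle_word_val (shuffle_behind _ (normal_mul _ _))).
by rewrite behind_push //; exact: normal_reduced.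
Qed.

Lemma vhead_mul_adj v w (x : S v) g : edge v w ->
  vhead w ('in x * g) = vhead w g.
Proof.
move=> /asboolP vw.
by rewrite /vhead (shuffle_front _ (normal_mul _ _)) front_push_adj.
Qed.

Lemma vhead_mul_nadj v w (x : S v) g : v <> w -> ~ edge v w ->
  x * vhead v g <> 1 -> vhead w ('in x * g) = 1.
Proof.
move=> /eqP vw /asboolPn nvw xg.
by rewrite /vhead (shuffle_front _ (normal_mul _ _)) front_push_nadj.
Qed.

End GraphProductTheory.

(** * Graph products are right LCM *)

Section GraphProductLCM.
Variables (G : graph) (S : G -> monoidType).
Hypothesis S_LCM : forall w, right_LCM (S w).
Notation P := (graph_product S).
Notation word := (seq {w : G & S w}).
Notation "''in' x" := (graph_product_in x) (at level 8).
Implicit Types (g h : P) (l q : word) (v w : G).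

(** It suffices to cancel one letter [x]: left multiplication by it multiplies the part in [S w] by
    [x], which is cancelled in [S w], and leaves the rest unchanged. *)
Lemma graph_product_cancel : left_cancellative P.
Proof.
elim/graph_product_ind => [t r|w x g IH t r]; first by rewrite !mul1g.
rewrite -!mulgA => e; apply: IH; move: (g * t) (g * r) e => {t r} t r e.
rewrite (vhead_vrest w t) (vhead_vrest w r) -(vrest_mul x t) -(vrest_mul x r) e.
congr ('in _ * _); apply: (@lcm_cancel (S w) _ x) => //.
by rewrite -!vhead_mul e.
Qed.

Definition linv g := exists2 h, h * g = 1 & g * h = 1.

Lemma linv_mul g h : linv g -> linv h -> linv (g * h).
Proof.
move=> [g' gg gg'] [h' hh hh']; exists (h' * g').
  by rewrite mulgA -(mulgA h') gg mulg1.
by rewrite mulgA -(mulgA g) hh' mulg1.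
Qed.

(** In a left cancellative monoid a right inverse is two-sided. *)
Lemma linv_in w (x y : S w) : x * y = 1 -> linv ('in x).
Proof.
move=> xy; exists ('in y); rewrite -graph_product_in_mul ?xy
  ?graph_product_in1 //.
suff -> : y * x = 1 by rewrite graph_product_in1.
by apply: (@lcm_cancel (S w) _ x) => //; rewrite mulgA xy mul1g mulg1.
Qed.

Definition linked w l : Prop := forall a, a \in l -> edge (tag a) w.

Lemma linked_comm w (x : S w) l : linked w l ->
  'in x * word_val l = word_val l * 'in x.
Proof.
elim: l => [|a l IH] lw; first by rewrite /word_val big_nil mulg1 mul1g.
rewrite word_val_consE -mulgA -IH; last first.
  by move=> b bl; apply: lw; rewrite inE bl orbT.
rewrite !mulgA; congr (_ * _); apply/esym/graph_product_in_comm/lw.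
by rewrite inE eqxx.
Qed.

Lemma vhead_linked w l g : linked w l -> vhead w (word_val l * g) = vhead w g.
Proof.
elim: l => [|a l IH] lw; first by rewrite /word_val big_nil mul1g.
rewrite word_val_consE -mulgA vhead_mul_adj; last by apply: lw;
  rewrite inE eqxx.
by apply: IH => b bl; apply: lw; rewrite inE bl orbT.
Qed.

(* A noninvertible syllable of s that does not commute with S_w blocks S_w in
   every product s z. If there is none, then s is, up to a right factor that is
   invertible, a product of an element of S_w and of syllables commuting with
   S_w. *)
Lemma vhead_dichotomy l w :
  (exists (a : S w) q (u : P), [/\ word_val l = 'in a * (word_val q * u),
       linked w q, size q <= size l & linv u]) \/
  (exists a : S w, forall z, vhead w (word_val l * z) = a).
Proof.
have [n] := ubnP (size l); elim: n l w => // n IH [|[v x] l] w ln.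
  left; exists 1, [::], 1; split=> //; last by exists 1; rewrite mul1g.
  by rewrite graph_product_in1 /word_val big_nil !mulg1.
have {}ln : size l < n by [].
rewrite word_val_cons; have [e|vw] := eqVneq v w.
  subst w; have [[a [q [u [-> lq sq uu]]]]|[a ea]] := IH _ v ln; [left|right].
    exists (x * a), q, u; split=> //=; last exact: leqW.
    by rewrite graph_product_in_mul -!mulgA.
  by exists (x * a) => z; rewrite -mulgA vhead_mul ea.
have [evw|nvw] := pselect (edge v w).
  have [[a [q [u [-> lq sq uu]]]]|[a ea]] := IH _ w ln; [left|right].
    exists a, (Tagged S x :: q), u; split=> //.
      rewrite word_val_cons !mulgA; congr (_ * _ * _).
      exact: graph_product_in_comm.
    by move=> b; rewrite inE => /orP[/eqP -> //|/lq].
  by exists a => z; rewrite -mulgA vhead_mul_adj.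
have const : (forall z, x * vhead v (word_val l * z) <> 1) ->
    exists a : S w, forall z, vhead w ('in x * word_val l * z) = a.
  by move=> xz; exists 1 => z; rewrite -mulgA; apply: vhead_mul_nadj => //;
    apply/eqP.
(* With [v] and [w] distinct and nonadjacent, everything depends on whether [x] can be cancelled by
   the [S v]-part of what follows. If that part is constantly [b] and [x * b = 1], the cancellation
   shortens the word. *)
have [[b [q [u [lE lq sq uu]]]]|[b eb]] := IH _ v ln; last first.
  have [xb|xb] := pselect (x * b = 1); last by right; apply: const => z;
    rewrite eb.
  have lE : 'in x * word_val l = word_val (behind v (normal (word_val l))).
    rewrite {1}(vhead_vrest v (word_val l)) -{1}(mulg1 (word_val l)) eb.
    by rewrite mulgA -graph_product_in_mul xb graph_product_in1 mul1g.
  have sl := leq_trans (size_behind v _) (size_normal_word_val l).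
  rewrite lE; have [[a [q [u [-> lq sq uu]]]]|] := IH _ w (leq_ltn_trans sl ln).
    left; exists a, q, u; split=> //.
    exact: leq_trans sq (leq_trans sl _).
  by right.
(* The syllable at [v] can vanish only if [x * b] has a right inverse. It is then invertible, and as
   [q] is linked to [v] it moves past [q] into the invertible right factor. *)
have [[c xbc]|nc] := pselect (exists c, x * b * c = 1); last first.
  right; apply: const => z; rewrite lE -mulgA vhead_mul mulgA => e.
  by apply: nc; eexists; exact: e.
have sE : 'in x * word_val l = word_val q * ('in (x * b) * u).
  by rewrite lE mulgA -graph_product_in_mul !mulgA linked_comm.
have xbu : linv ('in (x * b) * u) by apply: linv_mul => //; exact: linv_in xbc.
rewrite sE.
have [[a [q' [u' [-> lq' sq' uu']]]]|[a ea]] := IH _ w (leq_ltn_trans sq ln).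
  left; exists a, q', (u' * ('in (x * b) * u)); split=> //.
  - by rewrite !mulgA.
  - exact: leq_trans sq' (leq_trans sq _).
  - exact: linv_mul.
by right; exists a => z; rewrite -mulgA.
Qed.

(** In the first case of [vhead_dichotomy] the lcm is that of [a] and [y] in [S w], since [q]
    commutes with [S w] and [u] is invertible. In the second case the constant part [a] is a
    multiple of [y], hence so is [s]. *)
Lemma graph_product_lcm_in s w (y : S w) :
  rmeets s ('in y : P) -> exists p r, lcm_pair s ('in y) p r.
Proof.
move=> /rmeetsE[z0 [k0 e0]].
have := vhead_dichotomy (normal s) w; rewrite word_val_normal.
move=> [[a [q [u [sE lq _ [u' u'u uu']]]]]|[a ea]].
  have hE z : vhead w (s * z) = a * vhead w (u * z).
    by rewrite sE -!mulgA vhead_mul vhead_linked.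
  have ay : rmeets a y.
    by apply/rmeetsE; exists (vhead w (u * z0)), (vhead w k0);
      rewrite -hE e0 vhead_mul.
  have [a' [y' [ey uy]]] := rmeets_lcm (S_LCM w) ay.
  exists (u' * 'in a'), ('in y' * word_val q); split=> [|z k ez].
    rewrite sE -!mulgA (mulgA u u') uu' mul1g -(linked_comm _ lq).
    by rewrite !mulgA -!graph_product_in_mul ey.
  have [|c [c1 c2]] := uy (vhead w (u * z)) (vhead w k).
    by rewrite -hE ez vhead_mul.
  have zE : z = u' * 'in a' * ('in c * vrest w (u * z)).
    rewrite -mulgA (mulgA _ 'in c) -graph_product_in_mul -c1 -vhead_vrest.
    by rewrite mulgA u'u mul1g.
  eexists; split; first exact: zE.
  apply: (@graph_product_cancel ('in y)); rewrite -ez {1}zE.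
  rewrite sE -!mulgA (mulgA u u') uu' mul1g.
  rewrite (mulgA _ 'in a') -(linked_comm a' lq) !mulgA -!graph_product_in_mul
    ey.
  by [].
have [c ac] : exists c, a = y * c.
  by exists (vhead w k0); rewrite -(ea z0) e0 vhead_mul.
exists 1, ('in c * vrest w s); split=> [|z k ez].
  by rewrite mulgA -graph_product_in_mul -ac -(ea 1) !mulg1 -vhead_vrest.
exists z; split; first by rewrite mul1g.
apply: (@graph_product_cancel ('in y)).
rewrite -ez [X in X * _ = _](vhead_vrest w s) !mulgA -graph_product_in_mul -ac.
by rewrite -(ea 1) mulg1.
Qed.

(* If s S and y S meet in y y' S, then s S and y t S meet in the y-multiple of
   the intersection of y' S and t S. *)
Lemma graph_product_right_LCM : right_LCM P.
Proof.
apply: right_LCM_of_lcm_pair; first exact: graph_product_cancel.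
move=> s t; elim/graph_product_ind: t s => [s _|w y t IH s].
  by exists 1, s; exact: lcm_pair1.
move=> /rmeetsE[p [q epq]].
have [|x [y' u]] := @graph_product_lcm_in s w y.
  by apply/rmeetsE; exists p, (t * q); rewrite mulgA.
have [|z [_ zq]] := u.2 p (t * q); first by rewrite mulgA.
have [|y1 [t1 u1]] := IH y'; first by apply/rmeetsE; exists z, q.
by exists (x * y1), t1; exact: lcm_pair_mul u u1.
Qed.

End GraphProductLCM.

(** * The universal property of graph products *)

Section GraphProductLift.
Variables (G : graph) (S : G -> monoidType) (N : monoidType).
Variable f : forall w, S w -> N.
Hypothesis f1 : forall w, f (1 : S w) = 1.
Hypothesis fM : forall w (x y : S w), f (x * y) = f x * f y.
Hypothesis fC : forall v w (x : S v) (y : S w), edge v w ->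
  f x * f y = f y * f x.
Notation P := (graph_product S).

Definition word_lift (l : seq {w : G & S w}) : N :=
  \big[*%g/1]_(a <- l) f (tagged a).

Lemma word_lift_cat l l' : word_lift (l ++ l') = word_lift l * word_lift l'.
Proof. exact: big_cat. Qed.

Lemma word_lift_free_product l l' :
  congruence_gen (@free_product_rel G S) l l' -> word_lift l = word_lift l'.
Proof.
elim=> {l l'} [l l' []|//|//|l1 l l2 _ -> _ ->//|l1 l1' l2 l2' _ e1 _ e2].
- by move=> w; rewrite /word_lift big_seq1 big_nil f1.
- by move=> w x y; rewrite /word_lift big_cons !big_seq1 fM.
- by rewrite !word_lift_cat e1 e2.
Qed.

Lemma word_lift_repr_mul (p q : free_product S) :
  word_lift (repr (p * q)) = word_lift (repr p) * word_lift (repr q).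
Proof.
rewrite -word_lift_cat; apply: word_lift_free_product.
by apply/quot_projP; rewrite quot_projK.
Qed.

Lemma word_lift_repr_in w (x : S w) :
  word_lift (repr (free_product_in x)) = f x.
Proof.
rewrite (@word_lift_free_product _ (letter x)).
  by rewrite /word_lift big_seq1.
by apply/quot_projP; rewrite quot_projK.
Qed.

Lemma word_lift_graph_product p q :
  congruence_gen (@graph_product_rel G S) p q ->
  word_lift (repr p) = word_lift (repr q).
Proof.
elim=> {p q} [p q [v w x y vw]|//|//|p1 p p2 _ -> _ ->//|p p' q q' _ ep _ eq].
  by rewrite !word_lift_repr_mul !word_lift_repr_in fC.
by rewrite !word_lift_repr_mul ep eq.
Qed.

Definition graph_product_lift (g : P) : N := word_lift (repr (repr g)).

Lemma graph_product_lift_in w (x : S w) :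
  graph_product_lift (graph_product_in x) = f x.
Proof.
rewrite -word_lift_repr_in; apply: word_lift_graph_product.
by apply/quot_projP; rewrite quot_projK.
Qed.

Lemma graph_product_lift_mul : {morph graph_product_lift : x y / x * y}.
Proof.
move=> g h; rewrite -word_lift_repr_mul; apply: word_lift_graph_product.
by apply/quot_projP; rewrite quot_projK quot_proj_mul !quot_projK.
Qed.

Lemma graph_product_lift1 : graph_product_lift 1 = 1.
Proof.
transitivity (word_lift (repr (1 : free_product S))).
  by apply: word_lift_graph_product; apply/quot_projP; rewrite quot_projK.
rewrite (@word_lift_free_product _ [::]) /word_lift ?big_nil //.
by apply/quot_projP; rewrite quot_projK.
Qed.

End GraphProductLift.

(** Serves to insert one letter into the factor of its own component in a product over all
    components. *)
Lemma big_mul_commute (I : eqType) (N : monoidType) (r : seq I) (F : I -> N)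
    (i0 : I) (X : N) :
  uniq r -> i0 \in r -> (forall i, i <> i0 -> X * F i = F i * X) ->
  \big[*%g/1]_(i <- r) ((if i == i0 then X else 1) * F i) =
  X * \big[*%g/1]_(i <- r) F i.
Proof.
elim: r => //= i r IH /andP[ir ur]; rewrite inE !big_cons => i0r XF.
have [ei|ne] := eqVneq i i0; last first.
  by rewrite IH // ?mul1g ?mulgA ?XF //;
    [exact/eqP | case: eqVneq i0r ne => // ->].
rewrite mulgA; congr (_ * _); apply: eq_big_seq => j jr.
by case: eqP => [e|_]; [move: ir; rewrite ei -e jr | rewrite mul1g].
Qed.

(** * Decomposition along coconnected components *)

Section ComponentDecomposition.
Variables (L : graph) (S : L -> monoidType).
Notation J := (set_type (coconn_comps L)).
Notation P := (graph_product S).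
Notation Pj j := (subgraph_product S (val (j : J))).
Implicit Types (j k : J) (v w : L) (g h : P).

Lemma comp_unique j k v : val j v -> val k v -> j = k.
Proof.
have compE (i : J) : val i v -> val i = coconn_comp v.
  by have [u _ <-] := set_eltP i => uv; exact/coconn_comp_eq.
by move=> /compE jE /compE kE; apply: val_inj; rewrite /= jE kE.
Qed.

(** A missing edge would join the two components in the complementary graph. *)
Lemma edge_between_comps j k v w : j <> k -> val j v -> val k w -> edge v w.
Proof.
move=> jk jv kw; apply: contrapT => nvw; apply: jk;
  apply: (@comp_unique j k v) => //.
have [u _ uE] := set_eltP k; move: kw; rewrite -uE => uw.
by apply: rt_trans uw _; apply: rt_step => /edge_sym.
Qed.

Definition comp_of v : J := set_elt (imageP (@coconn_comp L) (I : setT v)).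

Lemma comp_ofP v : val (comp_of v) v.
Proof. exact: rt_refl. Qed.

(** Letters outside the component go to [1], so that the projection onto one summand is an instance
    of the universal property. *)
Definition sub_letter j v (x : S v) : Pj j :=
  if pselect (val j v) is left h
  then @subgraph_product_in L S (val j) (@set_elt L (val j) v h) x else 1.

Definition sub_proj j : P -> Pj j := graph_product_lift (@sub_letter j).
Definition sub_incl j : Pj j -> P :=
  @graph_product_lift (full_subgraph (val j)) (fun u => S (val u)) P
    (fun u x => @graph_product_in L S (val u) x).

Lemma sub_letterE j (w : full_subgraph (val j)) (x : S (val w)) :
  sub_letter j x = subgraph_product_in (w := w) x.
Proof.
rewrite /sub_letter; case: pselect => [h|[]]; last exact: set_eltP.
case: w x h => v hv /= x h; rewrite /set_elt.
by rewrite (Prop_irrelevance (mem_set h) hv).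
Qed.

Lemma sub_letter_out j v (x : S v) : ~ val j v -> sub_letter j x = 1.
Proof. by rewrite /sub_letter; case: pselect. Qed.

Lemma sub_letter1 j v : sub_letter j (1 : S v) = 1.
Proof.
rewrite /sub_letter; case: pselect => // h; exact: graph_product_in1.
Qed.

Lemma sub_letterM j v (x y : S v) :
  sub_letter j (x * y) = sub_letter j x * sub_letter j y.
Proof.
rewrite /sub_letter; case: pselect => [h|_]; last by rewrite mulg1.
exact: graph_product_in_mul.
Qed.

Lemma sub_letterC j v w (x : S v) (y : S w) : edge v w ->
  sub_letter j x * sub_letter j y = sub_letter j y * sub_letter j x.
Proof.
rewrite /sub_letter => vw.
case: pselect => [hv|_]; last by rewrite mulg1 mul1g.
case: pselect => [hw|_]; last by rewrite mulg1 mul1g.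
exact: graph_product_in_comm.
Qed.

Lemma sub_proj_in j v (x : S v) : sub_proj j (graph_product_in x) = sub_letter
  j x.
Proof.
exact: (graph_product_lift_in (@sub_letter1 j) (@sub_letterM j)
  (@sub_letterC j)).
Qed.

Lemma sub_proj_mul j : {morph sub_proj j : x y / x * y}.
Proof.
exact: (graph_product_lift_mul (@sub_letter1 j) (@sub_letterM j)
  (@sub_letterC j)).
Qed.

Lemma sub_proj1 j : sub_proj j 1 = 1.
Proof.
exact: (graph_product_lift1 (@sub_letter1 j) (@sub_letterM j) (@sub_letterC j)).
Qed.

Lemma sub_incl_in j (w : full_subgraph (val j)) (x : S (val w)) :
  sub_incl (subgraph_product_in (w := w) x) = graph_product_in x.
Proof.
apply: graph_product_lift_in => [u|u a b|u1 u2 a b e].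
- exact: graph_product_in1.
- exact: graph_product_in_mul.
- exact: graph_product_in_comm.
Qed.

Lemma sub_incl_mul j : {morph @sub_incl j : x y / x * y}.
Proof.
apply: graph_product_lift_mul => [u|u a b|u1 u2 a b e].
- exact: graph_product_in1.
- exact: graph_product_in_mul.
- exact: graph_product_in_comm.
Qed.

Lemma sub_incl1 j : @sub_incl j 1 = 1.
Proof.
apply: graph_product_lift1 => [u|u a b|u1 u2 a b e].
- exact: graph_product_in1.
- exact: graph_product_in_mul.
- exact: graph_product_in_comm.
Qed.

Lemma sub_projK j (a : Pj j) : sub_proj j (sub_incl a) = a.
Proof.
elim/graph_product_ind: a => [|w x a IH]; first by rewrite sub_incl1 sub_proj1.
rewrite sub_incl_mul sub_proj_mul IH; congr (_ * _).
by rewrite [X in sub_proj j X]sub_incl_in sub_proj_in sub_letterE.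
Qed.

Lemma sub_proj_incl_neq j k (a : Pj k) : j <> k -> sub_proj j (sub_incl a) = 1.
Proof.
move=> jk; elim/graph_product_ind: a => [|w x a IH].
  by rewrite sub_incl1 sub_proj1.
rewrite sub_incl_mul sub_proj_mul IH mulg1.
rewrite [X in sub_proj j X]sub_incl_in sub_proj_in sub_letter_out // => jw.
by apply: jk; apply: comp_unique jw _; exact: set_eltP.
Qed.

Lemma sub_incl_letter_comm v (x : S v) k (a : Pj k) : k <> comp_of v ->
  graph_product_in x * sub_incl a = sub_incl a * graph_product_in x.
Proof.
move=> kv; elim/graph_product_ind: a => [|w y a IH].
  by rewrite sub_incl1 mul1g mulg1.
rewrite sub_incl_mul [X in _ * (X * _)]sub_incl_in [X in X * _ * _]sub_incl_in.
rewrite -mulgA -IH !mulgA; congr (_ * _); apply: graph_product_in_comm.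
apply: (@edge_between_comps (comp_of v) k); first exact/nesym.
  exact: comp_ofP.
exact: set_eltP.
Qed.

(** The list [r] is any duplicate-free one containing [r0], so that two elements can be compared
    over a common list of components. *)
Lemma sub_decomposition g : exists r0 : seq J, forall r, uniq r ->
  {subset r0 <= r} -> g = \big[*%g/1]_(j <- r) sub_incl (sub_proj j g).
Proof.
elim/graph_product_ind: g => [|w x g [r0 IH]].
  by exists [::] => r _ _; rewrite big1 // => j _; rewrite sub_proj1 sub_incl1.
exists (comp_of w :: r0) => r ur sr.
have wr : comp_of w \in r by apply: sr; rewrite inE eqxx.
rewrite {1}(IH _ ur); last by move=> j jr; apply: sr; rewrite inE jr orbT.
rewrite -(@big_mul_commute _ _ r _ (comp_of w)) // => [|k kw]; last first.
  exact: sub_incl_letter_comm.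
apply: eq_bigr => j _; rewrite sub_proj_mul sub_incl_mul; congr (_ * _).
rewrite sub_proj_in; case: eqP => [->|jw].
  have h := comp_ofP w.
  by rewrite (@sub_letterE (comp_of w) (@set_elt L _ w h) x) sub_incl_in.
rewrite sub_letter_out ?sub_incl1 // => jv; apply: jw.
by apply: comp_unique jv _; exact: comp_ofP.
Qed.

Lemma sub_proj_finite g : finite_set [set j | sub_proj j g <> 1].
Proof.
elim/graph_product_ind: g => [|w x g IH].
  by apply: sub_finite_set (finite_set0 J) => j /=; rewrite sub_proj1.
apply: sub_finite_set (_ : finite_set (comp_of w |` _)); last first.
  by rewrite finite_setU; split; [exact: finite_set1 | exact: IH].
move=> j /= jn; have [->|jw] := pselect (j = comp_of w); [by left|right].
move: jn; rewrite /= sub_proj_mul sub_proj_in sub_letter_out ?mul1g // => jv.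
by apply: jw; apply: comp_unique jv _; exact: comp_ofP.
Qed.

Definition decomposition g : direct_sum (fun j => Pj j) :=
  exist (fun f => f \in @finitely_supported J (fun j => Pj j))
    (fun j => sub_proj j g) (mem_set (sub_proj_finite g)).

Lemma decomposition_morphism : monoid_morphism decomposition.
Proof.
split=> [|g h]; apply/val_inj/functional_extensionality_dep => j /=.
  exact: sub_proj1.
exact: sub_proj_mul.
Qed.

Lemma decomposition_bijective : bijective decomposition.
Proof.
suff : set_bij setT setT decomposition by rewrite setTT_bijective.
split=> // [g h _ _ e|f _].
  have [r1 e1] := sub_decomposition g; have [r2 e2] := sub_decomposition h.
  have ur := undup_uniq (r1 ++ r2).
  have s1 : {subset r1 <= undup (r1 ++ r2)}.
    by move=> j; rewrite mem_undup mem_cat => ->.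
  have s2 : {subset r2 <= undup (r1 ++ r2)}.
    by move=> j; rewrite mem_undup mem_cat => ->; rewrite orbT.
  have ej j : sub_proj j g = sub_proj j h.
    exact: (congr1 (fun f : direct_sum _ => val f j) e).
  rewrite (e1 _ ur s1) [RHS](e2 _ ur s2).
  by apply: eq_bigr => j _; rewrite ej.
have /finite_seqP[r rE] := set_eltP f.
exists (\big[*%g/1]_(j <- undup r) sub_incl (val f j)) => //.
apply/val_inj/functional_extensionality_dep => k /=.
(* Coordinate [k] of the product receives at most one nontrivial factor: either [k] is listed
   exactly once, or its entry is [1]. *)
have : k \in undup r \/ val f k = 1.
  rewrite mem_undup; have [|nk] := boolP (k \in r); first by left.
  right; apply: contrapT => fk; move: nk => /negP; apply.
  by have : [set` r] k by rewrite -rE.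
have := undup_uniq r; elim: (undup r) => [_|j s IH /= /andP[js us]].
  by rewrite big_nil sub_proj1 => -[|->].
rewrite inE big_cons sub_proj_mul; have [->|kj] := eqVneq k j => /= kjs.
  rewrite sub_projK; suff -> : sub_proj j
    (\big[*%g/1]_(i <- s) sub_incl (val f i)) = 1.
    by rewrite mulg1.
  elim: s js {IH us kjs} => [|i s IH]; first by rewrite big_nil sub_proj1.
  rewrite inE negb_or => /andP[ji /IH sE].
  by rewrite big_cons sub_proj_mul sE sub_proj_incl_neq ?mulg1 //; exact/eqP.
by rewrite sub_proj_incl_neq ?mul1g ?IH //; exact/eqP.
Qed.

Lemma decomposition_in j (w : full_subgraph (val j)) (x : S (val w)) :
  val (decomposition (graph_product_in x)) =
  dfwith (fun k => 1 : Pj k) (subgraph_product_in (w := w) x).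
Proof.
apply/functional_extensionality_dep => k /=; rewrite sub_proj_in.
have [e|jk] := eqVneq j k.
  by subst k; rewrite dfwith_in sub_letterE.
rewrite dfwith_out // sub_letter_out // => kw; move/eqP: jk; apply.
by apply: comp_unique kw; exact: set_eltP.
Qed.

End ComponentDecomposition.

(** * Cardinals of finite sets *)

Section Cardinality.
Local Open Scope card_scope.

Lemma card_set_seq (T : choiceType) (r : seq T) : uniq r ->
  [set` r] #= `I_(size r).
Proof.
move=> ur; have -> : [set` r] = [set` [fset x in r]%fset].
  by apply/seteqP; split=> x /=; rewrite !inE.
by apply/card_eq_fsetP; rewrite card_fseq undup_id.
Qed.

Lemma ncard_eq (T : choiceType) (A : set T) n : ncard A = Some n <-> A #= `I_n.
Proof.
rewrite /ncard; split=> [|An].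
  case: pselect => // fA [<-].
  by have [m Am] := (finite_setP A).1 fA; rewrite (card_fset_set Am).
case: pselect => [fA|[]]; first by rewrite (card_fset_set An).
by apply/finite_setP; exists n.
Qed.

End Cardinality.

(** * Representatives of core classes *)

Section ClassReps.
Variable M : monoidType.
Hypothesis M_LCM : right_LCM M.
Implicit Types (A : set M) (r : seq M) (s t : M).
Local Open Scope card_scope.

Definition inequivalent r := uniq (map (@core_class M) r).

(** A finite transversal given as a list, so that counting classes becomes comparing lengths. *)
Definition class_reps A r :=
  [/\ forall s, s \in r -> A s, inequivalent r &
      forall s, A s -> exists2 x, x \in r & core_eq s x].

Lemma inequivalent_inj r s t :
  inequivalent r -> s \in r -> t \in r -> core_eq s t -> s = t.
Proof.
rewrite /inequivalent; elim: r => //= x r IH /andP[xr /IH {}IH].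
have ncl y : y \in r -> ~ core_eq x y.
  move=> yr /core_class_eq xy; move/negP: xr; apply.
  by rewrite xy //; exact: map_f.
rewrite !inE => /orP[/eqP->|sr] /orP[/eqP->|tr] // e; last exact: IH.
  by case: (ncl _ tr).
by case: (ncl _ sr); exact: core_eq_sym.
Qed.

Lemma map_inequivalent (T : eqType) (f : T -> M) (r : seq T) : uniq r ->
  (forall x y, x \in r -> y \in r -> core_eq (f x) (f y) -> x = y) ->
  inequivalent (map f r).
Proof.
move=> ur inj; rewrite /inequivalent -map_comp map_inj_in_uniq // => x y xr yr.
by move=> /core_class_eq => /(_ M_LCM); exact: inj.
Qed.

Lemma inequivalent_uniq r : inequivalent r -> uniq r.
Proof. exact: map_uniq. Qed.

Lemma class_reps_card A r :
  class_reps A r -> @core_class M @` A #= `I_(size r).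
Proof.
move=> [rA ur Ar]; rewrite -(size_map (@core_class M)).
suff -> : @core_class M @` A = [set` map (@core_class M) r].
  exact: card_set_seq.
apply/seteqP; split=> [_ [s /Ar[x xr sx] <-]|_ /mapP[x xr ->]] /=; last first.
  by exists x => //; exact: rA.
by rewrite (core_class_eq M_LCM s x).2 //; exact: map_f.
Qed.

Lemma class_reps_of_card A n : @core_class M @` A #= `I_n ->
  exists2 r, class_reps A r & size r = n.
Proof.
move=> An; have : finite_set (@core_class M @` A) by apply/finite_setP;
  exists n.
move=> /finite_seqP[cs csE].
have [r [rA rcs]] : exists r, (forall s, s \in r -> A s) /\
    map (@core_class M) r = undup cs.
  have : forall c, c \in undup cs -> (@core_class M @` A) c.
    by move=> c; rewrite mem_undup => ccs; rewrite csE.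
  elim: (undup cs) => [|c cs' IH] H; first by exists [::].
  have [|r [rA rE]] := IH; first by move=> d dcs; apply: H;
    rewrite inE dcs orbT.
  have [|s sA sc] := H c; first by rewrite inE eqxx.
  exists (s :: r); split; last by rewrite /= rE sc.
  by move=> t; rewrite inE => /orP[/eqP->|/rA].
have ur : inequivalent r by rewrite /inequivalent rcs undup_uniq.
have tr : class_reps A r.
  split=> // s sA; have : core_class s \in map (@core_class M) r.
    rewrite rcs mem_undup; have : (@core_class M @` A) (core_class s) by exists
      s.
    by rewrite csE.
  by move=> /mapP[x xr /core_class_eq sx]; exists x => //; exact: sx.
exists r => //; apply/card_eq_II; apply: card_eq_trans An.
by rewrite card_eq_sym; exact: class_reps_card.
Qed.

(** Pigeonhole: the classes of [r'] are among those of [r], and there are enough of them. The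
    surjectivity arguments for levels and components rest on this. *)
Lemma class_reps_of_size A r r' : class_reps A r ->
  (forall s, s \in r' -> A s) -> inequivalent r' -> size r <= size r' ->
  class_reps A r'.
Proof.
move=> [rA ur Ar] r'A ur' sz; split=> // s sA.
have sub : {subset map (@core_class M) r' <= map (@core_class M) r}.
  move=> _ /mapP[x /r'A /Ar[y yr xy] ->].
  by rewrite (core_class_eq M_LCM x y).2 //; exact: map_f.
have [|_ eqi] := uniq_min_size ur' sub; first by rewrite !size_map.
have [y yr sy] := Ar _ sA.
have := map_f (@core_class M) yr; rewrite -eqi => /mapP[x xr' yx];
  exists x => //.
by apply: core_eq_trans sy _ => //; exact/core_class_eq.
Qed.

(** If [x * y] and [x' * y'] are core equivalent, then [x] and [x'] meet and hence coincide; left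
    cancellation then compares [y] and [y']. *)
Lemma inequivalent_products r1 r2 : inequivalent r1 -> inequivalent r2 ->
  (forall x x', x \in r1 -> x' \in r1 -> rmeets x x' -> core_eq x x') ->
  inequivalent [seq x * y | x <- r1, y <- r2].
Proof.
move=> u1 u2 dis.
pose st := [seq (x, y) | x <- r1, y <- r2].
have -> : [seq x * y | x <- r1, y <- r2] = map (fun p => p.1 * p.2) st.
  by rewrite map_allpairs.
apply: map_inequivalent.
  by apply: allpairs_uniq => [||[a b] [c d] _ _ /= e//];
    exact: inequivalent_uniq.
move=> p q /allpairsP[[x y] /= [xr yr ->]] /allpairsP[[x' y'] /= [x'r y'r ->]]
  /= e.
have xx' : x = x'.
  apply: (inequivalent_inj u1) => //; apply: dis => //.
  have [a [b [_ _ eab]]] := e.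
  by apply/rmeetsE; exists (y * a), (y' * b); rewrite !mulgA.
subst x'; congr (_, _); apply: (inequivalent_inj u2) => //.
exact: core_eq_cancel e.
Qed.

Definition idx_members C : set M := [set s | noncore_irr M s /\ idx s = C].

Lemma ncard_idx C n : coconn_comps (core_graph M) C ->
  ncard C = Some n <-> @core_class M @` idx_members C #= `I_n.
Proof.
move=> /comps_idx[s hs ->]; rewrite ncard_eq.
have -> : @core_class M @` idx_members (idx s) = val @` idx s.
  apply/seteqP; split=> [_ [t [ht ts] <-]|_ [v sv <-]].
    exists (irr_class (set_elt ht)) => //.
    exact/(idx_mem (set_elt hs) (set_elt ht)).
  have [t vt] := irr_classP v; subst v; exists (val t) => //; split.
    exact: set_eltP.
  exact/(idx_mem (set_elt hs)).
have im : val @` idx s #= idx s.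
  by apply: inj_card_eq => u v _ _; exact: val_inj.
split=> e; first exact: card_eq_trans im e.
by apply: card_eq_trans e; rewrite card_eq_sym.
Qed.

End ClassReps.

(** * Free generation of submonoids *)

Section FreeGeneration.

Lemma prod_mset_seq (I : choiceType) (k : I -> nat) (r : seq I) :
  (\prod_(i <- seq_mset r) k i = \prod_(i <- r) k i)%N.
Proof. exact/perm_big/perm_eq_seq_mset. Qed.

(** Reindexes the family along a bijection of [I] with [A] and replaces multisets by lists up to
    permutation. The default [0] stands for infinite cardinality, which the first condition
    excludes. *)
Lemma freely_generatesE (I T : choiceType) (f : I -> T) (A : set T)
    (n : I -> option nat) (n' : T -> option nat) :
  injective f -> (forall i, A (f i)) -> (forall C, A C -> exists i, f i = C) ->
  (forall i, n i = n' (f i)) ->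
  freely_generates_nontrivial n <->
  [/\ forall C, A C -> exists2 k, n' C = Some k & (0 < k)%N,
      forall r r' : seq T, (forall C, C \in r -> A C) ->
        (forall C, C \in r' -> A C) ->
        (\prod_(C <- r) odflt 0 (n' C) = \prod_(C <- r') odflt 0 (n' C))%N ->
        perm_eq r r' &
      exists2 C, A C & odflt 0%N (n' C) <> 1%N].
Proof.
move=> finj fA fsurj nn'.
have lift (r : seq T) : (forall C, C \in r -> A C) -> exists r0, r = map f r0.
  elim: r => [|C r IH] rA; first by exists [::].
  have [|r0 ->] := IH; first by move=> D Dr; apply: rA; rewrite inE Dr orbT.
  have [|i <-] := fsurj C; first by apply: rA; rewrite inE eqxx.
  by exists (i :: r0).
split=> [[k [nk k0 kinj [m mk]]]|[fin inj [C CA C1]]].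
  have nfk i : n' (f i) = Some (k i) by rewrite -nn'.
  have prodE (r0 : seq I) :
      (\prod_(C <- map f r0) odflt 0 (n' C) = \prod_(i <- seq_mset r0) k i)%N.
    by rewrite prod_mset_seq big_map; apply: eq_bigr => i _; rewrite nfk.
  split=> [C /fsurj[i <-]|r r' /lift[r0 ->] /lift[r1 ->]|].
  - by exists (k i); rewrite ?nfk.
  - by rewrite !prodE => /kinj/eq_seq_msetP; exact: perm_map.
  - apply: contrapT => all1; apply: mk; apply: big1 => i _.
    apply: contrapT => ki; apply: all1; exists (f i) => //.
    by rewrite nfk.
have nE i : n i = Some (odflt 0%N (n' (f i))).
  by rewrite nn'; have [k -> _] := fin _ (fA i).
exists (fun i => odflt 0%N (n' (f i))); split=> // [i|m m' e|].
- by have [k -> ] := fin _ (fA i).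
- rewrite -(seq_mset_id m) -(seq_mset_id m'); apply/eq_seq_msetP.
  apply: (perm_map_inj finj); apply: inj; rewrite ?big_map //.
  + by move=> _ /mapP[i _ ->].
  + by move=> _ /mapP[i _ ->].
- have [i iC] := fsurj _ CA; exists (seq_mset [:: i]).
  by rewrite prod_mset_seq big_seq1 iC.
Qed.

End FreeGeneration.

(** * Structure of a generalized scale *)

Section ScaleForward.
Variables (M : monoidType) (N : M -> nat).
Hypothesis M_LCM : right_LCM M.
Hypothesis N_scale : is_generalized_scale N.
Implicit Types (s t x y a b : M) (l r : seq M).

Let N_gt0 s : 0 < N s.
Proof. by case: N_scale => -[]. Qed.

Let N1 : N 1 = 1%N.
Proof. by case: N_scale => -[]. Qed.

Let NM s t : N (s * t) = (N s * N t)%N.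
Proof. by case: N_scale => -[]. Qed.

Let N_same s t : N s = N t -> core_eq s t \/ perp s t.
Proof. by case: N_scale => _ _ + _; exact. Qed.

Let N_meets s t : N s = N t -> rmeets s t -> core_eq s t.
Proof. by move=> /N_same[]. Qed.

Let level_reps s :
  exists2 r, class_reps (N @^-1` [set N s]) r & size r = N s.
Proof.
by case: N_scale => _ + _ _ => /(_ (N s)) H; apply: class_reps_of_card => //;
  exact: H.
Qed.

(** Level [1] consists of a single class, that of [1]. Conversely a core element meets, and so is
    equivalent to, every representative of its own level, which therefore has one class. *)
Lemma scale_core s : N s = 1%N <-> core s.
Proof.
have [r [rA ur Ar] sz] := level_reps s; split=> [s1|cs].
  move: sz; rewrite s1; case: r {rA ur} Ar => [|x []] // Ar _.
  have [y] := Ar s erefl; rewrite inE => /eqP -> sx.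
  have [z] := Ar 1 (etrans N1 (esym s1));
    rewrite inE => /eqP -> /core_eq_sym x1.
  by apply/core_eq1 => //; exact: core_eq_trans sx x1.
apply/eqP; rewrite eqn_leq N_gt0 andbT -sz.
have sE x : x \in r -> core_eq s x.
  by move=> xr; apply: N_meets => //; rewrite (rA _ xr).
case: r {sz Ar rA} ur sE => [|x [|y r]] //= ur sE.
have := @inequivalent_inj M M_LCM [:: x, y & r] x y ur.
rewrite !inE !eqxx orbT => /(_ isT isT) xy.
move: ur => /=; rewrite /inequivalent /= xy ?inE ?eqxx //.
apply: (core_eq_trans M_LCM (core_eq_sym (sE x _)) (sE y _));
  by rewrite !inE eqxx ?orbT.
Qed.

Lemma scale_core_eq s t : core_eq s t -> N s = N t.
Proof.
move=> [a [b [/scale_core ca /scale_core cb /(congr1 N)]]].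
by rewrite !NM ca cb !muln1.
Qed.

(* The products of representatives of two levels represent the product
   level, as they are pairwise inequivalent and there are enough of them. *)
Lemma scale_factor s x0 y0 : N s = (N x0 * N y0)%N ->
  exists x y, [/\ N x = N x0, N y = N y0 & core_eq s (x * y)].
Proof.
move=> sE; have [r1 [r1A u1 _] sz1] := level_reps x0.
have [r2 [r2A u2 _] sz2] := level_reps y0.
have [r tr sz] := level_reps s.
have tr' : class_reps (N @^-1` [set N s]) [seq x * y | x <- r1, y <- r2].
  apply: (class_reps_of_size M_LCM tr).
  - move=> _ /allpairsP[[x y] /= [/r1A xr /r2A yr ->]].
    by rewrite /= NM xr yr sE.
  - apply: inequivalent_products => // x x' /r1A xr /r1A x'r; apply: N_meets.
    by rewrite xr x'r.
  - by rewrite sz size_allpairs sz1 sz2 sE.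
have [_ _ /(_ s erefl)[_ /allpairsP[[x y] /= [/r1A xr /r2A yr ->]]]] := tr'.
by exists x, y.
Qed.

Definition indecomposable_level s : Prop :=
  N s <> 1%N /\ forall x y, N s = (N x * N y)%N -> N x = 1%N \/ N y = 1%N.

Lemma scale_irr s : noncore_irr M s <-> indecomposable_level s.
Proof.
split=> [[ns hs]|[s1 hs]]; split.
- by move/scale_core.
- move=> x y /scale_factor[x' [y' [<- <- [a [b [ca cb e]]]]]].
  have [||cx|cy] := hs a x' (y' * b) => //; first by rewrite mulgA.
    by left; exact/scale_core.
  by right; apply/scale_core/(core_mul_left cy).
- by move/scale_core.
- move=> a t r /scale_core ca /(congr1 N); rewrite !NM ca muln1 => /hs.
  by rewrite !scale_core.
Qed.

Lemma scale_irr_level s t : N s = N t -> noncore_irr M s -> noncore_irr M t.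
Proof. by move=> st; rewrite !scale_irr /indecomposable_level st. Qed.

Lemma level_factorization s : exists2 l,
  forall x, x \in l -> noncore_irr M x & N s = N (\big[*%g/1]_(x <- l) x).
Proof.
have [n] := ubnP (N s); elim: n s => // n IH s; rewrite ltnS => sn.
have [s1|s1] := pselect (N s = 1%N); first by exists [::];
  rewrite // big_nil N1.
have [hs|] := pselect (noncore_irr M s).
  by exists [:: s] => [x|]; rewrite ?big_seq1 // inE => /eqP ->.
rewrite scale_irr => /not_andP[//|/existsNP[x /existsNP[y /not_implyP]]].
move=> [sE /not_orP[/eqP x1 /eqP y1]].
have x2 : 1 < N x by rewrite ltn_neqAle eq_sym x1 N_gt0.
have y2 : 1 < N y by rewrite ltn_neqAle eq_sym y1 N_gt0.
have [|l1 h1 e1] := IH x.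
  by apply: leq_trans sn; rewrite sE ltn_Pmulr // N_gt0.
have [|l2 h2 e2] := IH y.
  by apply: leq_trans sn; rewrite sE ltn_Pmull // N_gt0.
exists (l1 ++ l2) => [z|]; first by rewrite mem_cat => /orP[/h1|/h2].
by rewrite big_cat /= NM -e1 -e2.
Qed.

Lemma scale_prod l : N (\big[*%g/1]_(x <- l) x) = (\prod_(x <- l) N x)%N.
Proof. by apply: (big_morph N) => // x y; exact: NM. Qed.

Lemma scale_lift_factorization s l : N s = (\prod_(x <- l) N x)%N ->
  exists2 l', map N l' = map N l & core_eq s (\big[*%g/1]_(x <- l') x).
Proof.
elim: l s => [|x0 l IH] s; rewrite ?big_nil ?big_cons => sE.
  exists [::] => //; rewrite big_nil; exact/core_eq1/scale_core.
move: sE; rewrite -scale_prod => /scale_factor[x [y [xE yE sxy]]].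
have [|l' l'E yl'] := IH y; first by rewrite yE scale_prod.
exists (x :: l'); first by rewrite /= xE l'E.
rewrite big_cons; apply: core_eq_trans sxy _ => //; exact: core_eq_mull.
Qed.

Lemma scale_noncore_factorable : noncore_factorable M.
Proof.
move=> s ns; have [l hl] := level_factorization s; rewrite scale_prod.
move=> /scale_lift_factorization[l' l'E sl']; exists l'; split=> // x xl'.
have : N x \in map N l by rewrite -l'E map_f.
by move=> /mapP[y /hl hy yx]; exact: scale_irr_level hy.
Qed.

(** A common multiple of level [N s * N t] is the lcm up to a core factor: as [N t] is
    indecomposable, either the excess [z] or the cofactor [p] has level [1], and the latter would
    force [N s = N t]. *)
Lemma lcm_levels s t x y : noncore_irr M s -> noncore_irr M t -> N s <> N t ->
  N x = N t -> N y = N s -> core_eq (s * x) (t * y) ->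
  exists p q, [/\ lcm_pair s t p q, core_eq x p, N p = N t & N q = N s].
Proof.
move=> hs ht st xt ys [a [b [ca cb e]]].
have [|p [q [epq u]]] := rmeets_lcm M_LCM (_ : rmeets s t).
  by apply/rmeetsE; exists (x * a), (y * b); rewrite !mulgA.
have [|z [xz _]] := u (x * a) (y * b); first by rewrite !mulgA.
have := congr1 N epq; rewrite !NM => Npq.
have := congr1 N xz; rewrite !NM (scale_core a).2 // muln1 xt => Nxz.
have /scale_irr[t1 /(_ _ _ Nxz)[p1|z1]] := ht.
  move: Npq; rewrite p1 muln1 => sE.
  have /scale_irr[_ /(_ _ _ sE)[//|q1]] := hs.
  by case: st; rewrite sE q1 muln1.
move: Nxz; rewrite z1 muln1 => pt.
exists p, q; split=> //.
  by exists a, z; split=> //; exact/scale_core.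
by apply/eqP; rewrite -(eqn_pmul2l (N_gt0 t)) -Npq -pt mulnC.
Qed.

Lemma core_eq_transport s t y : core_eq s t ->
  exists2 y', core_eq (s * y) (t * y') & N y' = N y.
Proof.
move=> st; have [a [b [ca cb e]]] := st.
have [y' [a' [ca' ya]]] := core_pull M_LCM y ca.
have sy : core_eq (s * y) (t * (b * y')).
  exists a', 1; split=> //; first exact: core1.
  by rewrite mulg1 -mulgA -ya !mulgA e.
exists (b * y') => //; move/scale_core_eq: sy; rewrite !NM (scale_core_eq st).
by move/eqP; rewrite eqn_pmul2l // => /eqP.
Qed.

(* For x in the level of t there is t' in that level with s x ~ t' y; this
   defines an injection, hence a bijection, of the finite set of classes of the
   level, so t itself meets s. *)
Lemma irr_levels_lcm s t : noncore_irr M s -> noncore_irr M t -> N s <> N t ->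
  exists x y, [/\ lcm_pair s t x y, N x = N t & N y = N s].
Proof.
move=> hs ht st.
have ex x : exists t', N x = N t -> N t' = N t /\
    exists2 y, N y = N s & core_eq (s * x) (t' * y).
  have [xt|xt] := pselect (N x = N t); last by exists x.
  have [|t' [y [t't ys sx]]] := @scale_factor (s * x) t s.
    by rewrite NM xt mulnC.
  by exists t' => _; split=> //; exists y.
have [f fE] := choice ex.
have [r tr sz] := level_reps t; have [rA ur _] := tr.
have lcmf x : N x = N t ->
    exists p q, [/\ lcm_pair s (f x) p q, core_eq x p & N p = N t].
  move=> xt; have [fx [y ys sx]] := fE x xt.
  have hf : noncore_irr M (f x) by apply: scale_irr_level ht; rewrite fx.
  have [||p [q [u xp pf qs]]] := lcm_levels hs hf _ _ ys sx.
  - by rewrite fx.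
  - by rewrite fx.
  - by exists p, q; split=> //; rewrite pf fx.
have tr' : class_reps (N @^-1` [set N t]) (map f r).
  apply: (class_reps_of_size M_LCM tr) => [_ /mapP[x /rA xr ->]||].
  - by have [] := fE _ xr.
  - apply: map_inequivalent => // [|x x' xr x'r ff].
      exact: inequivalent_uniq ur.
    apply: (inequivalent_inj M_LCM ur) => //.
    have [p [q [[epq _] xp pt]]] := lcmf _ (rA _ xr).
    have [p' [q' [[epq' u'] xp' pt']]] := lcmf _ (rA _ x'r).
    apply: core_eq_trans xp _ => //.
    apply: core_eq_trans (core_eq_sym xp') => //.
    apply: N_meets; first by rewrite pt pt'.
    (* Up to a core factor, [s * p] is also a multiple of [f x'], so [p] lies over [p'] up to a core
       factor. The two meet and have the same level. *)
    have [y' [a [b [ca cb e]]] _] := core_eq_transport q ff.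
    have [|z [z1 _]] := u' (p * a) (y' * b); first by rewrite !mulgA -e epq.
    by apply/rmeetsE; exists a, z.
  - by rewrite size_map.
have [_ _ /(_ t erefl)[_ /mapP[x /rA xr ->] tf]] := tr'.
have [_ [y ys sx]] := fE _ xr.
have [y' ty yy'] := core_eq_transport y (core_eq_sym tf).
have sxt := core_eq_trans M_LCM sx ty.
have [|p [q [u _ pt qs]]] := lcm_levels hs ht st xr _ sxt; first by rewrite yy'.
by exists p, q.
Qed.

(** Irreducibles of different levels meet by [irr_levels_lcm], so orthogonality preserves the level;
    irreducibles of one level are equivalent or orthogonal, so they share a component. *)
Lemma scale_idx s t : noncore_irr M s -> noncore_irr M t ->
  idx s = idx t <-> N s = N t.
Proof.
move=> hs ht; split=> [|st]; last by apply: idx_close => //; exact: N_same.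
apply: idx_invariant => // {s t hs ht} s t hs ht [/scale_core_eq //|st].
apply: contrapT => nst; apply: st.
have [x [y [[e _] _ _]]] := irr_levels_lcm hs ht nst.
by apply/rmeetsE; exists x, y.
Qed.

Lemma scale_edge_free : edge_free_components (core_graph M).
Proof.
apply/edge_free_componentsE => // s t hs ht /scale_idx st.
by apply: N_meets; exact: st.
Qed.

Lemma scale_balanced : balanced_factorization M.
Proof.
apply/balancedE => // s t hs ht; rewrite scale_idx // => st.
have [x [y [u xt ys]]] := irr_levels_lcm hs ht st.
have hx : noncore_irr M x by exact: scale_irr_level ht.
have hy : noncore_irr M y by exact: scale_irr_level hs.
by exists y, x; split=> //; apply/scale_idx.
Qed.

(** Irreducible levels are prime: some [x] of level [N s] divides the product up to a core factor
    [a]. If no factor had this level, [x] would pass through all of them with its level unchanged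
    and become a left factor of [a]. *)
Lemma irr_level_prime s l u : noncore_irr M s ->
  (forall x, x \in l -> noncore_irr M x) ->
  (\prod_(x <- l) N x)%N = (N s * N u)%N -> exists2 x, x \in l & N x = N s.
Proof.
move=> hs hl; rewrite -scale_prod => /scale_factor[x [y [xs _]]].
move=> [a [b [ca cb e]]]; rewrite -xs.
have hx : noncore_irr M x by exact: scale_irr_level hs.
apply: contrapT => nx.
suff [p [q [u' qx]]] : exists p q,
    lcm_pair x (\big[*%g/1]_(z <- l) z) p q /\ N q = N x.
  have [|z [_ az]] := u'.2 (y * b) a; first by rewrite mulgA.
  move: ca; rewrite az => /core_mul_left/scale_core.
  by rewrite qx; apply/eqP; move/scale_irr: hx => [/eqP].
move: hl nx; clear xs e; elim: l x hx => [|t l IH] {s hs} x hx hl nx.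
  by exists 1, x; rewrite big_nil; split=> //; exact: lcm_pair1.
have ht : noncore_irr M t by apply: hl; rewrite inE eqxx.
have xt : N x <> N t by move=> e; apply: nx; exists t; rewrite ?inE ?eqxx.
have [p [q [v pt qx]]] := irr_levels_lcm hx ht xt.
have [|||p' [q' [u' qq]]] := IH q.
- exact: scale_irr_level hx.
- by move=> z zl; apply: hl; rewrite inE zl orbT.
- by move=> [z zl zq]; apply: nx; exists z; rewrite ?inE ?zl ?orbT // zq.
- exists (p * p'), q'; rewrite big_cons qq; split=> //.
  exact: lcm_pair_mul v u'.
Qed.

Lemma scale_ncard s : noncore_irr M s -> ncard (idx s) = Some (N s).
Proof.
move=> hs; apply/ncard_idx => //; first exact: idx_comps.
have -> : idx_members (idx s) = N @^-1` [set N s].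
  apply/seteqP; split=> [t [ht]|t /= ts]; first by rewrite scale_idx.
  have ht : noncore_irr M t by exact: scale_irr_level hs.
  by split=> //; rewrite scale_idx.
by case: N_scale => _ + _ _; apply; exists s.
Qed.

(** Unique factorization by primality: a factor of the level of [s] is found in [l'] and
    cancelled. *)
Lemma irr_levels_free l l' : (forall x, x \in l -> noncore_irr M x) ->
  (forall x, x \in l' -> noncore_irr M x) ->
  (\prod_(x <- l) N x = \prod_(x <- l') N x)%N ->
  perm_eq (map (@idx M) l) (map (@idx M) l').
Proof.
elim: l l' => [|s l IH] l' hl hl'; rewrite ?big_nil ?big_cons.
  case: l' hl' => // x l' hl'; rewrite big_cons => /esym/eqP; rewrite muln_eq1.
  have /scale_irr[/eqP x1 _] : noncore_irr M x by apply: hl'; rewrite inE eqxx.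
  by rewrite (negPf x1).
have hs : noncore_irr M s by apply: hl; rewrite inE eqxx.
move=> e; have := e; rewrite -[X in (N s * X)%N]scale_prod => /esym e'.
have [x xl' xs] := irr_level_prime hs hl' e'.
have hx := hl' _ xl'; have ix : idx x = idx s by exact/scale_idx.
have px := perm_to_rem xl'.
apply: perm_trans (_ : perm_eq (map (@idx M) (x :: rem x l')) _); last first.
  by rewrite perm_sym; exact: perm_map.
rewrite /= ix perm_cons; apply: IH.
- by move=> y yl; apply: hl; rewrite inE yl orbT.
- by move=> y /mem_rem /hl'.
move: e; rewrite (perm_big _ px) big_cons xs => /eqP.
by rewrite eqn_pmul2l // => /eqP.
Qed.

Lemma scale_freely_generates : freely_generates_nontrivial
  (fun i : coconn_comps (core_graph M) => ncard (val i)).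
Proof.
apply/(@freely_generatesE _ _ val (coconn_comps (core_graph M)) _ (@ncard _)).
- exact: val_inj.
- by move=> i; exact: set_eltP.
- by move=> C hC; exists (set_elt hC).
- by [].
have lift (r : seq (set (core_graph M))) :
    (forall C, C \in r -> coconn_comps (core_graph M) C) ->
    exists l, [/\ forall x, x \in l -> noncore_irr M x, r = map (@idx M) l &
      (\prod_(C <- r) odflt 0 (ncard C) = \prod_(x <- l) N x)%N].
  elim: r => [|C r IH] rA; first by exists [::]; rewrite !big_nil.
  have [|l [hl -> e]] := IH; first by move=> D Dr; apply: rA;
    rewrite inE Dr orbT.
  have [|s hs ->] := @comps_idx M C; first by apply: rA; rewrite inE eqxx.
  exists (s :: l); split=> //; last by rewrite !big_cons e scale_ncard.
  by move=> x; rewrite inE => /orP[/eqP ->|/hl].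
split=> [C /comps_idx[s hs ->]|r r' /lift[l [hl -> ->]] /lift[l' [hl' -> ->]]|].
- by exists (N s); rewrite ?scale_ncard.
- exact: irr_levels_free.
- have [[_ _ _ [s s1]] _ _ _] := N_scale.
  have [[|x l] hl] := level_factorization s.
    by rewrite big_nil N1.
  have hx : noncore_irr M x by apply: hl; rewrite inE eqxx.
  move=> _; exists (idx x); first exact: idx_comps.
  by rewrite scale_ncard //=; have /scale_irr[] := hx.
Qed.

End ScaleForward.

(** * Construction of a generalized scale *)

Section ScaleBackward.
Variable M : monoidType.
Hypothesis M_LCM : right_LCM M.
Hypothesis M_edge_free : edge_free_components (core_graph M).
Hypothesis M_factorable : noncore_factorable M.
Hypothesis M_balanced : balanced_factorization M.
Notation comp := (set (core_graph M)).
Implicit Types (s t x y a b : M) (l : seq M) (m : seq comp) (C : comp).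

Let same_idx s t : noncore_irr M s -> noncore_irr M t -> idx s = idx t ->
  rmeets s t -> core_eq s t.
Proof. exact: (edge_free_componentsE M_LCM).1 M_edge_free s t. Qed.

Let balanced := (balancedE M_LCM).1 M_balanced.

Let idx_core_mull a s : core a -> noncore_irr M s -> idx (a * s) = idx s.
Proof.
exact: (core_act_restrictsE M_LCM).1 (balanced_core_act M_LCM M_balanced) a s.
Qed.

Definition lprod l : M := \big[*%g/1]_(x <- l) x.

Lemma lprod_nil : lprod [::] = 1.
Proof. exact: big_nil. Qed.

Lemma lprod_cons x l : lprod (x :: l) = x * lprod l.
Proof. exact: big_cons. Qed.

Lemma lprod_cat l l' : lprod (l ++ l') = lprod l * lprod l'.
Proof. exact: big_cat. Qed.

Definition all_irr l := forall x, x \in l -> noncore_irr M x.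

Lemma all_irr_cons x l : all_irr (x :: l) <-> noncore_irr M x /\ all_irr l.
Proof.
split=> [h|[hx hl] y]; last by rewrite inE => /orP[/eqP ->|/hl].
split=> [|y yl]; apply: h; first by rewrite inE eqxx.
by rewrite inE yl orbT.
Qed.

(** The core element travels through the factors one at a time; components are kept because the core
    action restricts to each of them. *)
Lemma core_pull_prod a l : core a -> all_irr l -> exists l' a',
  [/\ all_irr l', map (@idx M) l' = map (@idx M) l, core a' &
      a * lprod l' = lprod l * a'].
Proof.
move=> ca; elim: l a ca => [|x l IH] a ca.
  by exists [::], a; rewrite lprod_nil mulg1 mul1g.
move=> /all_irr_cons[hx hl].
have [x' [a1 [[e _] ca1]]] := core_lcm_ex M_LCM x ca.
have hx' : noncore_irr M x'.
  by apply: (noncore_irr_mull_inv M_LCM ca); rewrite e; exact: noncore_irr_mulr.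
have [l' [a2 [hl' il' ca2 e2]]] := IH _ ca1 hl.
exists (x' :: l'), a2; split=> //.
- exact/all_irr_cons.
- rewrite /= il' -(idx_core_mull ca hx') e; congr (_ :: _).
  by apply: idx_core_eq => //; exact: core_eq_mulr.
- by rewrite !lprod_cons mulgA e -!mulgA e2.
Qed.

(** The first factor absorbs [a]; the empty product is core anyway. *)
Lemma core_push_prod a l : core a -> all_irr l -> exists l',
  [/\ all_irr l', map (@idx M) l' = map (@idx M) l &
      core_eq (a * lprod l) (lprod l')].
Proof.
case: l => [|x l] ca hl.
  by exists [::]; split=> //; rewrite lprod_nil mulg1; exact/core_eq1.
move: hl => /all_irr_cons[hx hl]; exists (a * x :: l); split.
- by apply/all_irr_cons; split=> //; exact: noncore_irr_mull.
- by rewrite /= idx_core_mull.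
- by rewrite !lprod_cons mulgA; exact: core_eq_refl.
Qed.

(* How an irreducible x meets a product of irreducibles: it is blocked by the
   first factor in its own component, or it passes through all factors, or it
   can be split off as a left factor. *)
Variant irr_prod_spec x l : Prop :=
| IrrPerp of perp x (lprod l) & idx x \in map (@idx M) l
| IrrPass y p of idx x \notin map (@idx M) l & noncore_irr M y &
    lcm_pair x (lprod l) p y
| IrrSplit l' of all_irr l' & perm_eq (map (@idx M) l)
  (idx x :: map (@idx M) l')
    & core_eq (lprod l) (x * lprod l').

(** Against a factor [t] of the same component, edge-freeness leaves only equivalence or
    orthogonality; against any other, balanced factorization carries [x] past [t] as some [x'] of
    the same component. *)
Lemma irr_prodP x l : noncore_irr M x -> all_irr l -> irr_prod_spec x l.
Proof.
elim: l x => [|t l IH] x hx.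
  by move=> _; apply: (@IrrPass _ _ x 1); rewrite ?lprod_nil //;
    exact: lcm_pair1.
move=> /all_irr_cons[ht hl]; have [xt|xt] := pselect (idx x = idx t).
  have [m|nm] := pselect (rmeets x t); last first.
    apply: IrrPerp; last by rewrite /= xt inE eqxx.
    rewrite /perp lprod_cons rmeetsE => -[p [q e]]; apply: nm; apply/rmeetsE.
    by exists p, (lprod l * q); rewrite mulgA.
  have [a [b [ca cb e]]] := same_idx hx ht xt m.
  have [l1 [b' [hl1 il1 cb' e1]]] := core_pull_prod cb hl.
  have [l2 [hl2 il2 e2]] := core_push_prod ca hl1.
  apply: (@IrrSplit _ _ l2) => //; first by rewrite /= il2 il1 xt.
  rewrite lprod_cons; apply: core_eq_trans (core_eq_mull x e2) => //.
  exists b', 1; split=> //; first exact: core1.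
  by rewrite mulg1 -mulgA -e1 !mulgA e.
have [x' [t' [hx' ht' u ix' it']]] := balanced hx ht xt.
have nt : idx x \notin [:: idx t] by rewrite inE; apply/eqP.
case: (IH _ hx' hl) => [px xl|y p xl hy u'|l' hl' pl e].
- apply: IrrPerp; last by rewrite /= inE -ix' xl orbT.
  rewrite /perp lprod_cons rmeetsE => -[p [q e]]; apply: px; apply/rmeetsE.
  have [|z [_ z2]] := u.2 p (lprod l * q); first by rewrite mulgA.
  by exists z, q.
- apply: (@IrrPass _ _ y (t' * p)) => //.
    by rewrite /= inE negb_or -{2}ix' xl andbT; apply/eqP.
  by rewrite lprod_cons; exact: lcm_pair_mul u u'.
- apply: (@IrrSplit _ _ (t' :: l')); first exact/all_irr_cons.
    apply: (@perm_trans _ (idx t :: idx x' :: map (@idx M) l')).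
      by rewrite /= perm_cons.
    by rewrite ix' /= it'; apply/permP => P /=; rewrite addnCA.
  rewrite !lprod_cons mulgA u.1 -mulgA; exact: core_eq_mull.
Qed.

Lemma lprod_core l : all_irr l -> core (lprod l) -> l = [::].
Proof.
case: l => // x l /all_irr_cons[[nx _] _]; rewrite lprod_cons => /core_mul_left.
by move/nx.
Qed.

(** The first factor [x] must split off from the other product: orthogonality contradicts the common
    multiple, and passing through would give the core element [b] a noncore left factor. *)
Lemma factorization_unique l l' : all_irr l -> all_irr l' ->
  core_eq (lprod l) (lprod l') -> perm_eq (map (@idx M) l) (map (@idx M) l').
Proof.
elim: l l' => [|x l IH] l' hl hl'.
  rewrite lprod_nil => /core_core_eq/(_ (@core1 M)) H.
  by rewrite (lprod_core hl' H).
move: hl => /all_irr_cons[hx hl]; rewrite lprod_cons => e.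
have [a [b [ca cb eab]]] := e.
case: (irr_prodP hx hl') => [px _|y p _ [ny _] u|l2 hl2 pl e2].
- case: px; apply/rmeetsE; exists (lprod l * a), b.
  by rewrite mulgA.
- have [|z [_ bz]] := u.2 (lprod l * a) b; first by rewrite mulgA.
  by case: ny; move: cb; rewrite bz => /core_mul_left.
- rewrite perm_sym; apply: perm_trans pl _; rewrite /= perm_cons perm_sym.
  apply: IH => //; apply: (@core_eq_cancel _ M_LCM x).
  exact: core_eq_trans e e2.
Qed.

(** The multiset of components of the irreducible factors, as a list up to permutation. It is a
    relation; [degree_ex] and [degree_unique] supply existence and uniqueness. *)
Definition degree s m : Prop :=
  exists l, [/\ all_irr l, perm_eq (map (@idx M) l) m & core_eq s (lprod l)].

Lemma degree_perm s m m' : perm_eq m m' -> degree s m -> degree s m'.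
Proof.
by move=> mm' [l [? lm ?]]; exists l; split=> //; exact: perm_trans mm'.
Qed.

Lemma degree_prod l : all_irr l -> degree (lprod l) (map (@idx M) l).
Proof. by move=> hl; exists l; split=> //; exact: core_eq_refl. Qed.

Lemma degree_unique s m m' : degree s m -> degree s m' -> perm_eq m m'.
Proof.
move=> [l [hl lm sl]] [l' [hl' lm' sl']].
rewrite -(permPl lm) -(permPr lm'); apply: factorization_unique => //.
by apply: core_eq_trans sl' => //; exact: core_eq_sym.
Qed.

Lemma degree_core a : core a -> degree a [::].
Proof. by exists [::]; split=> //; rewrite lprod_nil; exact/core_eq1. Qed.

Lemma degree_irr x : noncore_irr M x -> degree x [:: idx x].
Proof.
move=> hx; exists [:: x]; split=> //; first exact/all_irr_cons.
by rewrite lprod_cons lprod_nil mulg1; exact: core_eq_refl.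
Qed.

(** The core elements [a] and [b] relating [s] to its factorization are moved into the factors of
    [t], which changes the factors but not their components. *)
Lemma degree_mul s t m m' : degree s m -> degree t m' ->
  degree (s * t) (m ++ m').
Proof.
move=> [l [hl lm [a [b [ca cb e]]]]] [l' [hl' lm' tl']].
have [t' [a' [ca' ta]]] := core_pull M_LCM t ca.
have [c [d [cc cd et]]] := tl'.
have [l1 [c1 [hl1 il1 cc1 e1]]] : exists l1 c1, [/\ all_irr l1,
    map (@idx M) l1 = map (@idx M) l', core c1 & a * lprod l1 = lprod l' * c1].
  exact: core_pull_prod.
have t'l1 : core_eq t' (lprod l1).
  apply: (@core_eq_cancel _ M_LCM a); rewrite ta e1.
  apply: core_eq_trans (core_eq_mulr _ ca') _ => //.
  by apply: core_eq_trans tl' _ => //; apply/core_eq_sym/core_eq_mulr.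
have [l2 [hl2 il2 e2]] := core_push_prod cb hl1.
exists (l ++ l2); split.
- by move=> x; rewrite mem_cat => /orP[/hl|/hl2].
- by rewrite map_cat il2 il1; exact: perm_cat.
- apply: (@core_eq_trans _ M_LCM (s * t * a')).
    exact/core_eq_sym/core_eq_mulr.
  rewrite -mulgA -ta mulgA e -mulgA lprod_cat.
  apply: core_eq_mull; apply: core_eq_trans e2 => //; exact: core_eq_mull.
Qed.

Definition all_comps m := forall C, C \in m -> coconn_comps (core_graph M) C.

Lemma degree_ex s : exists2 m, degree s m & all_comps m.
Proof.
have [cs|ns] := pselect (core s); first by exists [::];
  first exact: degree_core.
have [l [hl sl]] := M_factorable ns; exists (map (@idx M) l).
  by exists l; split.
by move=> _ /mapP[x /hl hx ->]; exact: idx_comps.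
Qed.

(** Unless the first factor of one product is orthogonal to the other product, it splits off there:
    it cannot pass, since its component occurs among the factors. *)
Lemma degree_same s t m : degree s m -> degree t m -> core_eq s t \/ perp s t.
Proof.
suff H l l' : all_irr l -> all_irr l' ->
    perm_eq (map (@idx M) l) (map (@idx M) l') ->
    core_eq (lprod l) (lprod l') \/ perp (lprod l) (lprod l').
  move=> [l [hl lm sl]] [l' [hl' lm' tl']].
  have [|e|p] := H _ _ hl hl'.
  - by rewrite (permPl lm) perm_sym.
  - left; apply: core_eq_trans sl _ => //; apply: core_eq_trans e _ => //.
    exact: core_eq_sym.
  - by right; move/(core_eq_rmeets2 M_LCM sl tl').
elim: l l' => [|x l IH] l' hl hl' pll'.
  have -> : l' = [::] by case: l' {hl'} pll' => // x l' /perm_size.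
  by left; exact: core_eq_refl.
move: hl => /all_irr_cons[hx hl].
case: (irr_prodP hx hl') => [px _|y p xl _ _|l2 hl2 pl e2].
- right; rewrite /perp lprod_cons rmeetsE => -[p [q e]]; apply: px.
  by apply/rmeetsE; exists (lprod l * p), q; rewrite mulgA.
- by move: xl; rewrite -(perm_mem pll') inE eqxx.
- rewrite lprod_cons; have [|e|p] := IH _ hl hl2.
  + by move: (perm_trans pll' pl); rewrite /= perm_cons.
  + left; apply: core_eq_trans (core_eq_mull x e) _ => //; exact: core_eq_sym.
  + right; move/(core_eq_rmeets2 M_LCM (core_eq_refl _) e2).
    by move/(rmeets_cancel M_LCM).
Qed.

Hypothesis M_free : freely_generates_nontrivial
  (fun i : coconn_comps (core_graph M) => ncard (val i)).

Let K C := odflt 0%N (ncard C).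

Let free : [/\ forall C, coconn_comps (core_graph M) C ->
                 exists2 k, ncard C = Some k & (0 < k)%N,
      forall m m', all_comps m -> all_comps m' ->
        (\prod_(C <- m) K C = \prod_(C <- m') K C)%N -> perm_eq m m' &
      exists2 C, coconn_comps (core_graph M) C & K C <> 1%N].
Proof.
move: M_free.
move/(@freely_generatesE _ _ val (coconn_comps (core_graph M)) _ (@ncard _)).
apply; [exact: val_inj | by move=> i; exact: set_eltP | | by []].
by move=> C hC; exists (set_elt hC).
Qed.

Lemma comp_reps C : coconn_comps (core_graph M) C ->
  exists2 r, class_reps (idx_members C) r & size r = K C.
Proof.
move=> hC; have [/(_ C hC)[k kC _] _ _] := free; rewrite /K kC.
by apply: class_reps_of_card => //; exact/ncard_idx.
Qed.

(* Pushing through t is injective on the finite set of classes of C, hence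
   surjective. *)
Lemma comp_pull C t y : coconn_comps (core_graph M) C -> noncore_irr M t ->
  idx t <> C -> noncore_irr M y -> idx y = C ->
  exists x a q, [/\ noncore_irr M x, idx x = C, core a & t * y * a = x * q].
Proof.
move=> hC ht tC hy yC; have [r tr sz] := comp_reps hC; have [rA ur _] := tr.
have ex x : exists y', noncore_irr M x -> idx x = C ->
    [/\ noncore_irr M y', idx y' = C & exists x', lcm_pair t x y' x'].
  have [[hx xC]|n] := pselect (noncore_irr M x /\ idx x = C); last first.
    by exists x => ? ?; case: n.
  have [|t' [x' [ht' hx' u it' ix']]] := balanced ht hx; first by rewrite xC.
  by exists x' => _ _; split=> //; [rewrite ix' | exists t'].
have [f fE] := choice ex.
have tr' : class_reps (idx_members C) (map f r).
  apply: (class_reps_of_size M_LCM tr); last by rewrite size_map.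
    move=> _ /mapP[x /rA[hx xC] ->].
    by have [] := fE _ hx xC.
  apply: map_inequivalent => // [|x x' xr x'r ff].
    exact: inequivalent_uniq ur.
  apply: (inequivalent_inj M_LCM ur) => //.
  have [hx xC] := rA _ xr; have [hx' x'C] := rA _ x'r.
  apply: same_idx => //; first by rewrite xC.
  have [_ _ [p [e _]]] := fE _ hx xC; have [_ _ [p' [e' _]]] := fE _ hx' x'C.
  have [a [b [_ _ eab]]] := ff.
  by apply/rmeetsE; exists (p * a), (p' * b); rewrite !mulgA -e -e' -!mulgA eab.
have [_ _ /(_ y (conj hy yC))[_ /mapP[x /rA[hx xC] ->] yf]] := tr'.
have [_ _ [p [e _]]] := fE _ hx xC; have [a [b [ca cb eab]]] := yf.
by exists x, a, (p * b); split; rewrite // mulgA -e -!mulgA eab.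
Qed.

(** Built from the last factor of [s] backwards: a factor in [C] serves itself, and past any other
    factor the element already found is carried by [comp_pull]. *)
Lemma comp_meets C s : coconn_comps (core_graph M) C ->
  exists x, [/\ noncore_irr M x, idx x = C & rmeets x s].
Proof.
move=> hC; have [_ [l [hl _ sl]] _] := degree_ex s.
suff [x [hx xC xl]] : exists x, [/\ noncore_irr M x, idx x = C & rmeets x
  (lprod l)].
  exists x; split=> //.
  exact: core_eq_rmeets2 (core_eq_refl x) (core_eq_sym sl) xl.
elim: l hl {sl} => [_|t l IH /all_irr_cons[ht hl]].
  have [x hx ->] := comps_idx hC; exists x; split=> //.
  by apply/rmeetsE; exists 1, x; rewrite lprod_nil mulg1 mul1g.
have [tC|tC] := pselect (idx t = C).
  exists t; split=> //; apply/rmeetsE; exists (lprod l), 1.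
  by rewrite lprod_cons mulg1.
have [y [hy yC yl]] := IH hl.
have [x [a [q [hx xC ca e]]]] := comp_pull hC ht tC hy yC.
exists x; split=> //.
have ya := core_eq_sym (core_eq_mulr y ca).
have /rmeetsE[u [v uv]] := core_eq_rmeets M_LCM ya yl.
by apply/rmeetsE; exists (q * u), v; rewrite lprod_cons mulgA -e -!mulgA -uv
  !mulgA.
Qed.

(** Gives condition (3) of a generalized scale: [comp_meets] handles one component, and the
    remaining ones are treated with the cofactor [p] of [s]. *)
Lemma degree_meets m s : all_comps m -> exists2 t, degree t m & rmeets s t.
Proof.
elim: m s => [|C m IH] s hm.
  exists 1; first exact/degree_core/core1.
  by apply/rmeetsE; exists 1, s; rewrite mulg1 mul1g.
have hC : coconn_comps (core_graph M) C by apply: hm; rewrite inE eqxx.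
have [x [hx xC /rmeetsE[p [q e]]]] := comp_meets s hC.
have [|t tm /rmeetsE[c [d e']]] := IH p.
  by move=> D Dm; apply: hm; rewrite inE Dm orbT.
exists (x * t).
  by have := degree_mul (degree_irr hx) tm; rewrite xC.
by apply/rmeetsE; exists (q * c), d; rewrite -mulgA -e' !mulgA e.
Qed.

(** Products of component representatives form a transversal. They exhaust the degree because an
    irreducible of [C] meeting [s] must split off from any factorization of [s]. *)
Lemma degree_reps m : all_comps m ->
  exists2 r, class_reps [set s | degree s m] r & size r =
    (\prod_(C <- m) K C)%N.
Proof.
elim: m => [|C m IH] hm.
  exists [:: 1]; last by rewrite big_nil.
  split=> // [s|s [l [hl lm sl]]].
    by rewrite inE => /eqP -> /=; apply: degree_core; exact: core1.
  exists 1; first by rewrite inE.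
  by case: l {hl} lm sl => [|x l /perm_size//]; rewrite lprod_nil.
have hC : coconn_comps (core_graph M) C by apply: hm; rewrite inE eqxx.
have [|r2 [r2A u2 Ar2] sz2] := IH.
  by move=> D Dm; apply: hm; rewrite inE Dm orbT.
have [r1 [r1A u1 Ar1] sz1] := comp_reps hC.
exists [seq x * y | x <- r1, y <- r2]; last first.
  by rewrite size_allpairs sz1 sz2 big_cons.
split.
- move=> _ /allpairsP[[x y] /= [/r1A[hx xC] /r2A /= yr ->]].
  by have := degree_mul (degree_irr hx) yr; rewrite xC.
- apply: inequivalent_products => // x x' /r1A[hx xC] /r1A[hx' x'C].
  by apply: same_idx; rewrite // xC.
move=> s [l [hl lm sl]].
have [x0 [hx0 x0C m0]] := comp_meets s hC.
have [x xr x0x] := Ar1 _ (conj hx0 x0C); have [hx xC] := r1A _ xr.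
have xl : rmeets x (lprod l) by exact: core_eq_rmeets2 x0x sl m0.
case: (irr_prodP hx hl) => [/(_ xl)//|y p xnl _ _|l2 hl2 pl e2].
  by move: xnl; rewrite (perm_mem lm) xC inE eqxx.
have dl2 : degree (lprod l2) m.
  apply: degree_perm (degree_prod hl2); rewrite -(perm_cons C) -{1}xC.
  by rewrite perm_sym; apply: perm_trans pl; rewrite perm_sym.
have [y yr l2y] := Ar2 _ dl2.
exists (x * y); first by apply/allpairsP; exists (x, y).
apply: core_eq_trans sl _ => //; apply: core_eq_trans e2 _ => //.
exact: core_eq_mull.
Qed.

Lemma generalized_scale_exists : has_generalized_scale M.
Proof.
have [Kfin Kinj [C0 hC0 C01]] := free.
have ex s : exists m, degree s m /\ all_comps m.
  by have [m] := degree_ex s; exists m.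
have [d dE] := choice ex.
pose N s := (\prod_(C <- d s) K C)%N.
have NE s m : degree s m -> N s = (\prod_(C <- m) K C)%N.
  by have [ds _] := dE s => /(degree_unique ds); exact: perm_big.
(* Free generation enters here: the level determines the multiset of components. *)
have Ndeg s t m : N s = N t -> degree s m -> degree t m.
  move=> st sm; have [sd sc] := dE s; have [td tc] := dE t.
  apply: degree_perm td; apply: perm_trans (degree_unique sd sm).
  by apply: Kinj => //; exact: esym.
exists N; split.
- split=> [s||s t|].
  + have [_ /=] := dE s; rewrite /N; elim: (d s) => [|C m IH] hm.
      by rewrite big_nil.
    rewrite big_cons muln_gt0 IH; last by move=> D Dm; apply: hm;
      rewrite inE Dm orbT.
    have [|k kC k0] := Kfin C; first by apply: hm; rewrite inE eqxx.
    by rewrite /K kC k0.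
  + by rewrite (NE 1 [::]) ?big_nil //; apply: degree_core; exact: core1.
  + have [[sd _] [td _]] := (dE s, dE t).
    by rewrite (NE _ _ (degree_mul sd td)) big_cat.
  + have [s hs sC] := comps_idx hC0; exists s.
    by rewrite (NE _ _ (degree_irr hs)) big_seq1 -sC.
- move=> _ [u _ <-]; have [ud uc] := dE u.
  have [r rA sz] := degree_reps uc.
  have -> : N @^-1` [set N u] = [set s | degree s (d u)].
    apply/seteqP; split=> [s /= su|s /= sm]; first exact: Ndeg ud.
    by rewrite (NE _ _ sm).
  by rewrite /N -sz; exact: class_reps_card.
- move=> s t st; have [sd _] := dE s.
  exact: degree_same sd (Ndeg _ _ _ st sd).
- move=> s _ [u _ <-]; have [ud uc] := dE u.
  have [t tm st] := degree_meets s uc; exists t => //.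
  by rewrite (NE _ _ tm).
Qed.

End ScaleBackward.

(** * Characterization of generalized scales on one monoid *)

Theorem generalized_scaleE (M : monoidType) : right_LCM M ->
  has_generalized_scale M <->
  [/\ edge_free_components (core_graph M), noncore_factorable M,
      balanced_factorization M &
      freely_generates_nontrivial
        (fun i : coconn_comps (core_graph M) => ncard (val i))].
Proof.
move=> H; split=> [[N HN]|[ef nf bal fg]]; last exact: generalized_scale_exists.
split.
- exact: scale_edge_free HN.
- exact: scale_noncore_factorable HN.
- exact: scale_balanced HN.
- exact: scale_freely_generates HN.
Qed.

(** * Direct sums of right LCM monoids *)

Section DirectSumTheory.
Variables (J : choiceType) (Mj : J -> monoidType) (P : monoidType).
Variable phi : P -> direct_sum Mj.
Hypothesis phi_morph : monoid_morphism phi.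
Hypothesis phi_bij : bijective phi.
Hypothesis P_LCM : right_LCM P.
Hypothesis Mj_LCM : forall j, right_LCM (Mj j).
Implicit Types (g h p q : P) (i j k : J).

(** The monoid [P] is only isomorphic to the direct sum; working through coordinates avoids
    transporting properties along [phi]. *)
Definition coord j g : Mj j := val (phi g) j.

Lemma coord1 j : coord j 1 = 1.
Proof. by rewrite /coord phi_morph.1. Qed.

Lemma coordM j : {morph coord j : g h / g * h}.
Proof. by move=> g h; rewrite /coord phi_morph.2. Qed.

Lemma coord_inj g h : (forall j, coord j g = coord j h) -> g = h.
Proof.
move=> e; apply: (bij_inj phi_bij); apply: val_inj.
exact: functional_extensionality_dep.
Qed.

Lemma coord_finite g : finite_set [set j | coord j g <> 1].
Proof. exact: set_eltP (phi g). Qed.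

Lemma coord_ex (f : forall j, Mj j) : finite_set [set j | f j <> 1] ->
  exists g, forall j, coord j g = f j.
Proof.
move=> ff; have [psi _ phiK] := phi_bij.
exists (psi (@set_elt (forall j, Mj j) (@finitely_supported J Mj) f ff)) => j.
by rewrite /coord phiK.
Qed.

(** Glues coordinatewise choices of two elements, typically a pair of cofactors. Outside the finite
    set [A] both are chosen to be [1], which secures finite support. *)
Lemma coord_glue (A : set J) (R : forall j, Mj j -> Mj j -> Prop) :
  finite_set A -> (forall j, exists x y, R j x y) ->
  (forall j, ~ A j -> R j 1 1) -> exists g h, forall j, R j (coord j g)
    (coord j h).
Proof.
move=> fA ex out.
have {}ex j : exists xy : Mj j * Mj j, R j xy.1 xy.2 /\ (~ A j -> xy = (1, 1)).
  have [Aj|nA] := pselect (A j); last by exists (1, 1); split=> //; exact: out.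
  by have [x [y xy]] := ex j; exists (x, y).
pose f j := sval (cid (ex j)).
have fR j : R j (f j).1 (f j).2 by rewrite /f; case: cid => xy [].
have fA1 j : ~ A j -> f j = (1, 1) by rewrite /f; case: cid => xy [].
have [|g gE] := @coord_ex (fun j => (f j).1).
  by apply: sub_finite_set fA => j /=; apply: contra_notP => /fA1 ->.
have [|h hE] := @coord_ex (fun j => (f j).2).
  by apply: sub_finite_set fA => j /=; apply: contra_notP => /fA1 ->.
by exists g, h => j; rewrite gE hE.
Qed.

(** Four slots cover comparing two pairs of cofactors; elsewhere the last two are filled with
    [1]. *)
Definition support g h p q : set J :=
  [set j | coord j g <> 1] `|` [set j | coord j h <> 1] `|`
  ([set j | coord j p <> 1] `|` [set j | coord j q <> 1]).

Lemma support_finite g h p q : finite_set (support g h p q).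
Proof. by rewrite !finite_setU; do !split; exact: coord_finite. Qed.

Lemma support_out g h p q j : ~ support g h p q j ->
  [/\ coord j g = 1, coord j h = 1, coord j p = 1 & coord j q = 1].
Proof.
by move=> n; split; apply: contrapT => n1; apply: n;
  [left; left | left; right | right; left | right; right].
Qed.

Lemma single_ex j (x : Mj j) g :
  exists h, coord j h = x /\ forall k, k <> j -> coord k h = coord k g.
Proof.
have [|h hE] := @coord_ex (dfwith (fun k => coord k g) x).
  apply: sub_finite_set (_ : finite_set (j |` [set k | coord k g <> 1])).
    move=> k /=; have [->|kj] := pselect (k = j); first by left.
    by rewrite dfwith_out; [right | apply/eqP/nesym].
  by rewrite finite_setU; split; [exact: finite_set1 | exact: coord_finite].
exists h; rewrite hE dfwith_in; split=> // k kj.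
by rewrite hE dfwith_out //; apply/eqP/nesym.
Qed.

Definition single j (x : Mj j) : P := sval (cid (single_ex x 1)).

Lemma coord_single j (x : Mj j) : coord j (single x) = x.
Proof. by rewrite /single; case: cid => h []. Qed.

Lemma coord_single_neq j k (x : Mj j) : k <> j -> coord k (single x) = 1.
Proof. by rewrite /single; case: cid => h [_ H] /H ->; rewrite coord1. Qed.

Lemma rmeets_coord g h : rmeets g h <->
  forall j, rmeets (coord j g) (coord j h).
Proof.
split=> [/rmeetsE[p [q e]] j|m].
  by apply/rmeetsE; exists (coord j p), (coord j q); rewrite -!coordM e.
have [|j|j|p [q pq]] := @coord_glue (support g h 1 1)
    (fun j x y => coord j g * x = coord j h * y).
- exact: support_finite.
- by have /rmeetsE := m j.
- by move=> /support_out[-> -> _ _].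
apply/rmeetsE; exists p, q; apply: coord_inj => j; rewrite !coordM; exact: pq.
Qed.

Lemma core_coord g : core g <-> forall j, core (coord j g).
Proof.
split=> [cg j t|cg t]; last by apply/rmeets_coord => j; exact: cg.
by have /rmeets_coord/(_ j) := cg (single t); rewrite coord_single.
Qed.

Lemma core_eq_coord g h :
  core_eq g h <-> forall j, core_eq (coord j g) (coord j h).
Proof.
split=> [[a [b [/core_coord ca /core_coord cb e]]] j|m].
  by exists (coord j a), (coord j b); split=> //; rewrite -!coordM e.
have [|j|j|p [q pq]] := @coord_glue (support g h 1 1)
    (fun j x y => [/\ core x, core y & coord j g * x = coord j h * y]).
- exact: support_finite.
- by have [a [b abE]] := m j; exists a, b.
- by move=> /support_out[-> -> _ _]; split=> //; exact: core1.
exists p, q; split; try by apply/core_coord => j; case: (pq j).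
by apply: coord_inj => j; rewrite !coordM; case: (pq j).
Qed.

Lemma lcm_pair_coord g h p q : lcm_pair g h p q <->
  forall j, lcm_pair (coord j g) (coord j h) (coord j p) (coord j q).
Proof.
split=> [[e u] j|m].
  split=> [|x y exy]; first by rewrite -!coordM e.
  have [p' [p'j p'k]] := single_ex x p; have [q' [q'j q'k]] := single_ex y q.
  have [|z [zp zq]] := u p' q'; last first.
    by exists (coord j z); rewrite -p'j -q'j zp zq !coordM.
  apply: coord_inj => k; rewrite !coordM; have [->|kj] := pselect (k = j).
    by rewrite p'j q'j.
  by rewrite p'k // q'k // -!coordM e.
split=> [|p' q' e].
  by apply: coord_inj => j; rewrite !coordM; case: (m j).
have [|j|j|z [_ zE]] := @coord_glue (support p q p' q')
    (fun j z _ => coord j p' = coord j p * z /\ coord j q' = coord j q * z).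
- exact: support_finite.
- have [_ /(_ (coord j p') (coord j q'))[|z zE]] := m j; last by exists z, 1.
  by rewrite -!coordM e.
- by move=> /support_out[-> -> -> ->]; rewrite mulg1.
by exists z; split; apply: coord_inj => j; rewrite coordM; case: (zE j).
Qed.

Lemma core_single j (x : Mj j) : core (single x) <-> core x.
Proof.
split=> [/core_coord/(_ j)|cx]; first by rewrite coord_single.
apply/core_coord => k; have [->|kj] := pselect (k = j).
  by rewrite coord_single.
by rewrite coord_single_neq //; exact: core1.
Qed.

Lemma single_core_eq j (x y : Mj j) : core_eq x y ->
  core_eq (single x) (single y).
Proof.
move=> xy; apply/core_eq_coord => k; have [->|kj] := pselect (k = j).
  by rewrite !coord_single.
by rewrite !coord_single_neq //; exact: core_eq_refl.
Qed.

Lemma single_rmeets j (x y : Mj j) : rmeets x y <->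
  rmeets (single x) (single y).
Proof.
split=> [xy|/rmeets_coord/(_ j)]; last by rewrite !coord_single.
apply/rmeets_coord => k; have [->|kj] := pselect (k = j).
  by rewrite !coord_single.
by rewrite !coord_single_neq //; exact: rmeets_refl.
Qed.

Definition block j g : Prop :=
  noncore_irr (Mj j) (coord j g) /\ forall k, k <> j -> core (coord k g).

(** Splitting off a noncore coordinate [j] factors [g], and irreducibility makes the complementary
    factor core. Conversely coordinate [j] decides any factorization, as factors of core coordinates
    are core. *)
Lemma noncore_irr_coord g : noncore_irr P g <-> exists j, block j g.
Proof.
split=> [[ng hg]|[j [[nj hj] hk]]].
  have [j nj] : exists j, ~ core (coord j g).
    by apply/existsNP; move/core_coord.
  exists j; have hk k : k <> j -> core (coord k g).
    move=> kj; apply: contrapT => nk.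
    have [r [rj rk]] := single_ex (1 : Mj j) g.
    have e : g * 1 = single (coord j g) * r.
      apply: coord_inj => l; rewrite !coordM coord1 mulg1.
      have [->|lj] := pselect (l = j); first by rewrite coord_single rj mulg1.
      by rewrite coord_single_neq // rk // mul1g.
    have [/core_single//|/core_coord/(_ k)] := hg _ _ _ (@core1 P) e.
    by rewrite rk.
  split=> //; split=> // a t r ca e.
  have [r' [rj rk]] := single_ex r g.
  have e' : g * single a = single t * r'.
    apply: coord_inj => l; rewrite !coordM.
    have [->|lj] := pselect (l = j); first by rewrite !coord_single rj.
    by rewrite !coord_single_neq // rk // mul1g mulg1.
  have [/core_single|/core_coord/(_ j)] := hg _ _ _ ((core_single a).2 ca) e'.
    by left.
  by rewrite rj; right.
split=> [/core_coord/(_ j)//|a t r /core_coord ca e].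
have ce l : coord l g * coord l a = coord l t * coord l r by rewrite -!coordM e.
have hl l : l <> j -> core (coord l t) /\ core (coord l r).
  move=> lj; have : core (coord l t * coord l r).
    by rewrite -ce; apply: core_mul => //; exact: hk.
  by move=> c; split; [exact: core_mul_left c | exact: core_mul_right c].
have [c|c] := hj _ _ _ (ca j) (ce j); [left|right]; apply/core_coord => l;
  have [->//|/hl[]//] := pselect (l = j).
Qed.

Lemma block_single j (x : Mj j) : noncore_irr (Mj j) x -> block j (single x).
Proof.
move=> hx; split=> [|k kj]; first by rewrite coord_single.
by rewrite coord_single_neq //; exact: core1.
Qed.

Lemma noncore_irr_single j (x : Mj j) :
  noncore_irr (Mj j) x -> noncore_irr P (single x).
Proof.
by move=> hx; apply/noncore_irr_coord; exists j; exact: block_single.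
Qed.

Lemma block_core_eq j g : block j g -> core_eq g (single (coord j g)).
Proof.
move=> [_ hk]; apply/core_eq_coord => k; have [->|kj] := pselect (k = j).
  by rewrite coord_single; exact: core_eq_refl.
by rewrite coord_single_neq //; apply/core_eq1 => //; exact: hk.
Qed.

Lemma core_not_irr (M : monoidType) (x : M) : core x -> ~ noncore_irr M x.
Proof. by move=> cx []. Qed.

Lemma idx_single j (x y : Mj j) : noncore_irr (Mj j) x ->
  noncore_irr (Mj j) y ->
  idx x = idx y -> idx (single x) = idx (single y).
Proof.
apply: (idx_invariant (Mj_LCM j) (F := fun x => idx (single x))) =>
  s t hs ht st.
apply: idx_close => //; try exact: noncore_irr_single.
case: st => [st|st]; first by left; exact: single_core_eq.
by right; move/single_rmeets.
Qed.

(* Elements of different blocks meet, so [idx] does not mix blocks. *)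
Lemma idx_coord g h : noncore_irr P g -> noncore_irr P h ->
  idx g = idx h <-> forall j, idx (coord j g) = idx (coord j h).
Proof.
move=> hg hh; split=> [e j|e].
  apply: (idx_invariant P_LCM (F := fun g => idx (coord j g))) e => // {hg hh}.
  move=> {}g {}h hg hh [/core_eq_coord gh|gh]; first exact: idx_core_eq.
  have [k nk] : exists k, ~ rmeets (coord k g) (coord k h).
    by apply/existsNP; move/rmeets_coord.
  have /noncore_irr_coord[i [hi gi]] := hg.
  have /noncore_irr_coord[l [hl hhl]] := hh.
  have ki : k = i by apply: contrapT => ki; apply: nk; exact: gi.
  have kl : k = l.
    by apply: contrapT => kl; apply/nk/rmeets_sym; exact: hhl.
  subst i l; have [->|jk] := pselect (j = k); first by apply: idx_close => //;
    right.
  by rewrite !idx0 //; apply: core_not_irr; [exact: hhl | exact: gi].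
have /noncore_irr_coord[j bg] := hg.
have hj : noncore_irr (Mj j) (coord j h) by apply: noncore_irr_idx (e j) bg.1.
have /noncore_irr_coord[k bh] := hh.
have jk : j = k by apply: contrapT => jk; case: hj => + _; apply; exact: bh.2.
subst k; rewrite (idx_core_eq P_LCM (block_core_eq bg)).
rewrite (idx_core_eq P_LCM (block_core_eq bh)).
by apply: idx_single => //; exact: bg.1.
Qed.

Lemma edge_free_coord : edge_free_components (core_graph P) <->
  forall j, edge_free_components (core_graph (Mj j)).
Proof.
split=> [/(edge_free_componentsE P_LCM) ef j|ef].
  apply/edge_free_componentsE => // x y hx hy xy /single_rmeets m.
  have : core_eq (single x) (single y).
    by apply: ef => //; try exact: noncore_irr_single; exact: idx_single.
  by move=> /core_eq_coord/(_ j); rewrite !coord_single.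
apply/edge_free_componentsE => // g h hg hh /(idx_coord hg hh) gh /rmeets_coord
  m.
apply/core_eq_coord => k.
have /noncore_irr_coord[j [hj hk]] := hg.
have hj' := noncore_irr_idx (gh j) hj.
have [->|kj] := pselect (k = j).
  by move/(edge_free_componentsE (Mj_LCM j)): (ef j); apply.
have /noncore_irr_coord[i [_ hk']] := hh.
have ij : i = j by apply: contrapT => /nesym/hk' c; case: hj' => + _; apply.
subst i; apply: (@core_eq_trans _ (Mj_LCM k) 1); first by apply/core_eq1 => //;
  exact: hk.
by apply/core_eq_sym/core_eq1 => //; exact: hk'.
Qed.

Lemma coord_prod j (l : seq P) :
  coord j (\big[*%g/1]_(x <- l) x) = \big[*%g/1]_(x <- map (coord j) l) x.
Proof.
by rewrite big_map; elim: l => [|x l IH];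
  rewrite ?big_nil ?coord1 // !big_cons coordM IH.
Qed.

(* Core factors of a product are absorbed by the next irreducible factor, or by
   the last one. *)
Lemma absorb_core (M : monoidType) (M_LCM : right_LCM M) (l : seq M) :
  (forall x, x \in l -> core x \/ noncore_irr M x) ->
  core (\big[*%g/1]_(x <- l) x) \/
  exists2 l', forall x, x \in l' -> noncore_irr M x &
    \big[*%g/1]_(x <- l) x = \big[*%g/1]_(x <- l') x.
Proof.
elim: l => [|x l IH] hl; first by left; rewrite big_nil; exact: core1.
have hx : core x \/ noncore_irr M x by apply: hl; rewrite inE eqxx.
rewrite big_cons; have [|c|[[|y l'] hl' ->]] := IH.
- by move=> y yl; apply: hl; rewrite inE yl orbT.
- case: hx => hx; first by left; exact: core_mul.
  right; exists [:: x * \big[*%g/1]_(x <- l) x]; last by rewrite big_seq1.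
  by move=> y; rewrite inE => /eqP ->; exact: noncore_irr_mulr.
- case: hx => hx; first by left; rewrite big_nil mulg1.
  right; exists [:: x]; last by rewrite big_nil big_seq1 mulg1.
  by move=> y; rewrite inE => /eqP ->.
right; case: hx => hx; last first.
  exists [:: x, y & l']; last by rewrite !big_cons.
  by move=> z; rewrite inE => /orP[/eqP ->//|/hl'].
exists (x * y :: l'); last by rewrite !big_cons mulgA.
move=> z; rewrite inE => /orP[/eqP ->|zl]; last by apply: hl';
  rewrite inE zl orbT.
by apply: noncore_irr_mull => //; apply: hl'; rewrite inE eqxx.
Qed.

(** Coordinates of irreducibles are irreducible or core, so [absorb_core] turns a factorization in
    [P] into one in a summand. Conversely the finitely many nontrivial coordinates are factored one
    at a time. *)
Lemma noncore_factorable_coord : noncore_factorable P <->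
  forall j, noncore_factorable (Mj j).
Proof.
split=> [nf j x nx|nf g _].
  have [|l [hl]] := nf (single x); first by move/core_single.
  move=> /core_eq_coord/(_ j); rewrite coord_single coord_prod => e.
  have [y|c|[l' hl' el']] := absorb_core (Mj_LCM j) (_ : forall y,
      y \in map (coord j) l -> core y \/ noncore_irr (Mj j) y).
  - move=> /mapP[h /hl /noncore_irr_coord[k [hk ck]] ->].
    have [->|jk] := pselect (j = k); first by right.
    by left; exact: ck.
  - by case: nx; apply: core_core_eq (core_eq_sym e) c.
  - by exists l'; rewrite -el'.
(* Triviality of the factors outside [r] keeps them from disturbing the coordinate added in the
   induction step. *)
suff H (r : seq J) g' : uniq r -> (forall k, k \notin r -> core (coord k g')) ->
    exists l, [/\ forall x, x \in l -> noncore_irr P x,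
      forall x k, x \in l -> k \notin r -> coord k x = 1 &
      core_eq g' (\big[*%g/1]_(x <- l) x)].
  have /finite_seqP[r rE] := coord_finite g.
  have [|k|l [hl _ e]] := H (undup r) g; first exact: undup_uniq.
    rewrite mem_undup => kr; suff -> : coord k g = 1 by exact: core1.
    apply: contrapT => gk; move/negP: kr; apply.
    by have : [set` r] k by rewrite -rE.
  by exists l.
elim: r g' => [|j r IH] g' /=.
  move=> _ hc; exists [::]; split=> //; rewrite big_nil.
  by apply/core_eq1 => //; apply/core_coord => k; exact: hc.
move=> /andP[jr ur] hc; have [g1 [g1j g1k]] := single_ex (1 : Mj j) g'.
have [|l [hl l1 e]] := IH g1 ur.
  move=> k kr; have [->|kj] := pselect (k = j); first by rewrite g1j;
    exact: core1.
  by rewrite g1k //; apply: hc; rewrite inE negb_or kr andbT; exact/eqP.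
have cl x : x \in l -> coord j x = 1 by move=> xl; exact: l1.
have prod1 : coord j (\big[*%g/1]_(x <- l) x) = 1.
  rewrite coord_prod big_map big_seq big1 // => x; exact: cl.
have [cj|nj] := pselect (core (coord j g')).
  exists l; split=> // [x k xl|].
    by rewrite inE negb_or => /andP[_]; exact: l1.
  apply: core_eq_trans e => //; apply/core_eq_coord => k.
  have [->|kj] := pselect (k = j); first by rewrite g1j; exact/core_eq1.
  by rewrite g1k //; exact: core_eq_refl.
have [lj [hlj ej]] := nf j _ nj.
exists (map (@single j) lj ++ l); split.
- by move=> x; rewrite mem_cat => /orP[/mapP[y /hlj hy ->]|/hl //];
  exact: noncore_irr_single.
- move=> x k; rewrite mem_cat inE negb_or =>
  /orP[/mapP[y _ ->]|xl] /andP[kj kr].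
    by rewrite coord_single_neq //; exact/eqP.
  exact: l1.
rewrite big_cat /=; apply/core_eq_coord => k;
  rewrite coordM coord_prod -map_comp.
have [->|kj] := pselect (k = j).
  rewrite prod1 mulg1 (eq_map (g := id)) ?map_id // => x /=.
  exact: coord_single.
rewrite big_map big1 => [|x _ /=]; last exact: coord_single_neq.
by rewrite mul1g -(g1k _ kj); move/core_eq_coord: e; exact.
Qed.

(** For the converse the cofactors are glued from the summands: where both coordinates are
    irreducible balance applies, and where exactly one is core the restricted core action keeps the
    index. *)
Lemma balanced_coord : balanced_factorization P <->
  forall j, balanced_factorization (Mj j) /\ core_act_restricts (Mj j).
Proof.
split=> [/(balancedE P_LCM) bal j|bal].
  suff H : balanced_factorization (Mj j) by split=> //;
    exact: balanced_core_act.
  apply/balancedE => // x y hx hy xy.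
  have ex := noncore_irr_single hx; have ey := noncore_irr_single hy.
  have [|p [q [hp hq u ip iq]]] := bal _ _ ex ey.
    by move=> /(idx_coord ex ey)/(_ j); rewrite !coord_single.
  move/(idx_coord hp ex)/(_ j): ip; move/(idx_coord hq ey)/(_ j): iq.
  rewrite !coord_single => iq ip.
  exists (coord j p), (coord j q); split=> //.
  - exact: noncore_irr_idx (esym ip) hx.
  - exact: noncore_irr_idx (esym iq) hy.
  - by move/lcm_pair_coord/(_ j): u; rewrite !coord_single.
apply/balancedE => // g h hg hh gh.
have irr_or_core f k : noncore_irr P f ->
    core (coord k f) \/ noncore_irr (Mj k) (coord k f).
  move=> /noncore_irr_coord[j [hj ck]].
  by have [->|/ck] := pselect (k = j); [right | left].
(* At a core coordinate the index equality says only that the cofactor is not irreducible; the two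
   implications keep it core, so that the glued cofactors lie in the blocks of [g] and [h]. *)
pose R k (x y : Mj k) := [/\ lcm_pair (coord k g) (coord k h) y x,
  idx x = idx (coord k g), idx y = idx (coord k h),
  core (coord k g) -> core x & core (coord k h) -> core y].
have ex k : exists x y, R k x y.
  have [bk] := bal k; move/(core_act_restrictsE (Mj_LCM k)) => res.
  have [cg|ig] := irr_or_core _ k hg; have [ch|ih] := irr_or_core _ k hh.
  - have [y [x [u cx]]] := core_lcm_ex (Mj_LCM k) (coord k h) cg.
    have cy := core_lcm ch (lcm_pair_sym u).
    by exists x, y; split=> //; rewrite !idx0 //; exact: core_not_irr.
  - have [y [x [u cx]]] := core_lcm_ex (Mj_LCM k) (coord k h) cg.
    have hy : noncore_irr (Mj k) y.
      apply: (noncore_irr_mull_inv (Mj_LCM k) cg); rewrite u.1.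
      exact: noncore_irr_mulr.
    exists x, y; split=> //; last by move/core_not_irr.
      by rewrite !idx0 //; exact: core_not_irr.
    (* Multiplying [y] by the core coordinate of [g] keeps its index, and the product is the
       coordinate of [h] times a core element. *)
    rewrite -(res _ _ cg hy) u.1; apply: idx_core_eq => //; exact: core_eq_mulr.
  - have [x [y [u cy]]] := core_lcm_ex (Mj_LCM k) (coord k g) ch.
    have hx : noncore_irr (Mj k) x.
      apply: (noncore_irr_mull_inv (Mj_LCM k) ch); rewrite u.1.
      exact: noncore_irr_mulr.
    exists x, y; split=> //; first exact: lcm_pair_sym.
    - rewrite -(res _ _ ch hx) u.1; apply: idx_core_eq => //;
      exact: core_eq_mulr.
    - by rewrite !idx0 //; exact: core_not_irr.
    - by move/core_not_irr.
  - have [|x [y [hx hy u ix iy]]] := (balancedE (Mj_LCM k)).1 bk _ _ ig ih.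
      (* Both [g] and [h] lie in block [k], so equal indices at this coordinate would give
         [idx g = idx h]. *)
      move=> e; apply: gh.
      have bk' f : noncore_irr P f -> noncore_irr (Mj k) (coord k f) ->
        block k f.
        move=> /noncore_irr_coord[j bj] fk; suff <- : j = k by exact: bj.
        by apply: contrapT => /nesym/bj.2 c; case: fk.
      rewrite (idx_core_eq P_LCM (block_core_eq (bk' _ hg ig))).
      rewrite (idx_core_eq P_LCM (block_core_eq (bk' _ hh ih))).
      exact: idx_single.
    by exists x, y; split=> // c; [case: ig | case: ih].
have [|k|p [q pq]] := @coord_glue (support g h 1 1) R _ ex.
- exact: support_finite.
- move=> /support_out[g1 h1 _ _]; rewrite /R g1 h1; split=> //;
  exact: lcm_pair1.
have blockR j f f' : block j f -> idx (coord j f') = idx (coord j f) ->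
    (forall k, core (coord k f) -> core (coord k f')) -> noncore_irr P f'.
  move=> [hj ck] e cc; apply/noncore_irr_coord; exists j; split.
    exact: noncore_irr_idx (esym e) hj.
  by move=> k /ck /cc.
have hp : noncore_irr P p.
  have /noncore_irr_coord[j bj] := hg; apply: (blockR j g) => // [|k].
    by case: (pq j).
  by case: (pq k).
have hq : noncore_irr P q.
  have /noncore_irr_coord[j bj] := hh; apply: (blockR j h) => // [|k].
    by case: (pq j).
  by case: (pq k).
exists p, q; split=> //.
- by apply/lcm_pair_coord => k; case: (pq k).
- by apply/idx_coord => // k; case: (pq k).
- by apply/idx_coord => // k; case: (pq k).
Qed.

Lemma class_reps_single j (x : Mj j) (r : seq (Mj j)) : noncore_irr (Mj j) x ->
  class_reps (idx_members (idx x)) r ->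
  class_reps (idx_members (idx (single x))) (map (@single j) r).
Proof.
move=> hx [rA ur Ar]; split.
- move=> _ /mapP[y /rA[hy yx] ->]; split; first exact: noncore_irr_single.
  exact: idx_single.
- apply: map_inequivalent => // [|y z yr zr /core_eq_coord/(_ j)].
    exact: inequivalent_uniq ur.
  rewrite !coord_single; exact: inequivalent_inj ur yr zr.
move=> g [hg /(idx_coord hg (noncore_irr_single hx)) gx].
have := gx j; rewrite coord_single => gjx.
have gj := noncore_irr_idx (esym gjx) hx.
have [y yr gy] := Ar _ (conj gj gjx).
exists (single y); first exact: map_f.
apply: core_eq_trans (single_core_eq gy) => //; apply: block_core_eq.
have /noncore_irr_coord[k bk] := hg; suff <- : k = j by [].
by apply: contrapT => /nesym/bk.2 c; case: gj.
Qed.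

Lemma class_reps_coord j (x : Mj j) (r : seq P) : noncore_irr (Mj j) x ->
  class_reps (idx_members (idx (single x))) r ->
  class_reps (idx_members (idx x)) (map (@coord j) r).
Proof.
move=> hx [rA ur Ar]; have ex := noncore_irr_single hx.
have rj g : g \in r -> block j g /\ idx (coord j g) = idx x.
  move=> /rA[hg /(idx_coord hg ex)/(_ j)]; rewrite coord_single => gx;
    split=> //.
  have [gj _] := noncore_irr_idx (esym gx) hx.
  have /noncore_irr_coord[k bk] := hg; suff <- : k = j by [].
  by apply: contrapT => /nesym/bk.2.
split.
- by move=> _ /mapP[g /rj[[hg _] gx] ->].
- apply: map_inequivalent => // [|g h gr hr gh];
  first exact: inequivalent_uniq ur.
  apply: (inequivalent_inj P_LCM ur) => //.
  have [[bg _] [bh _]] := (rj _ gr, rj _ hr).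
  apply: core_eq_trans (block_core_eq bg) _ => //.
  apply: core_eq_trans (single_core_eq gh) _ => //.
  exact/core_eq_sym/block_core_eq.
move=> y [hy yx].
have [|g gr /core_eq_coord/(_ j)] := Ar (single y).
  by split; [exact: noncore_irr_single | exact: idx_single].
by rewrite coord_single => yg; exists (coord j g) => //; exact: map_f.
Qed.

(** Embedding a summand and taking a coordinate carry transversals to transversals, so finiteness
    and the count pass in both directions. *)
Lemma ncard_idx_single j (x : Mj j) : noncore_irr (Mj j) x ->
  ncard (idx x) = ncard (idx (single x)).
Proof.
move=> hx; have hC := idx_comps hx; have hC' :=
  idx_comps (noncore_irr_single hx).
suff H n : ncard (idx x) = Some n <-> ncard (idx (single x)) = Some n.
  case e : (ncard (idx x)) => [n|]; first by move/H: e => ->.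
  by case e' : (ncard (idx (single x))) => [n|//]; move/H: e'; rewrite e.
rewrite !ncard_idx //; split=> /class_reps_of_card[] // r rA <-.
  rewrite -(size_map (@single j)); apply: class_reps_card => //.
  exact: class_reps_single.
rewrite -(size_map (@coord j)); apply: class_reps_card => //.
exact: class_reps_coord.
Qed.

Definition comp_rep j (C : coconn_comps (core_graph (Mj j))) : Mj j :=
  sval (cid2 (comps_idx (set_eltP C))).

Lemma comp_rep_irr j (C : coconn_comps (core_graph (Mj j))) :
  noncore_irr (Mj j) (comp_rep C).
Proof. by rewrite /comp_rep; case: cid2. Qed.

Lemma idx_comp_rep j (C : coconn_comps (core_graph (Mj j))) :
  idx (comp_rep C) = val C.
Proof. by rewrite /comp_rep; case: cid2. Qed.

(** Both families are reindexed by the components of the core graph of [P]: [f] sends a component of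
    a summand to that of an embedded representative, bijectively and preserving cardinality. *)
Lemma freely_generates_coord :
  freely_generates_nontrivial
    (fun i : coconn_comps (core_graph P) => ncard (val i)) <->
  freely_generates_nontrivial
    (fun i : {j : J & set_type (coconn_comps (core_graph (Mj j)))} =>
       ncard (val (tagged i))).
Proof.
pose f (i : {j : J & set_type (coconn_comps (core_graph (Mj j)))}) :
  set (core_graph P) := idx (single (comp_rep (tagged i))).
have hf (u : {j : J & set_type (coconn_comps (core_graph (Mj j)))}) :
    noncore_irr P (single (comp_rep (tagged u))).
  exact/noncore_irr_single/comp_rep_irr.
rewrite (@freely_generatesE _ _ f (coconn_comps (core_graph P)) _ (@ncard _)).
- apply: (@freely_generatesE _ _ val (coconn_comps (core_graph P))).
  + exact: val_inj.
  + by move=> i; exact: set_eltP.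
  + by move=> C hC; exists (set_elt hC).
  + by [].
- move=> i i' /(idx_coord (hf i) (hf i')) e.
  case: i i' e {f hf} => j C [j' C'] /= e.
  have ej := e j; rewrite coord_single in ej.
  have hj := noncore_irr_idx ej (comp_rep_irr C).
  have jj' : j = j'.
    apply: contrapT => jj'; move: hj; rewrite coord_single_neq //.
    by apply: core_not_irr; exact: core1.
  subst j'; move: ej; rewrite coord_single !idx_comp_rep => CC'.
  by congr existT; apply: val_inj.
- by move=> i; exact: idx_comps (hf i).
- move=> C /comps_idx[g hg ->]; have /noncore_irr_coord[j bj] := hg.
  exists (existT _ j (set_elt (idx_comps bj.1))).
  rewrite (idx_core_eq P_LCM (block_core_eq bj)) /f /=.
  apply: idx_single; [exact: comp_rep_irr | exact: bj.1 |].
  exact: (idx_comp_rep (set_elt (idx_comps bj.1))).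
- move=> [j C]; rewrite /f /= -ncard_idx_single ?idx_comp_rep //.
  exact: comp_rep_irr.
Qed.

Lemma has_generalized_scale_coord : has_generalized_scale P <->
  (forall j, [/\ edge_free_components (core_graph (Mj j)),
                 noncore_factorable (Mj j) & balanced_factorization (Mj j)]) /\
  freely_generates_nontrivial
    (fun i : {j : J & set_type (coconn_comps (core_graph (Mj j)))} =>
       ncard (val (tagged i))).
Proof.
rewrite -freely_generates_coord generalized_scaleE //.
split=> [[/edge_free_coord ef /noncore_factorable_coord nf /balanced_coord bal
  fg]|].
  by split=> // j; split=> //; case: (bal j).
move=> [H fg]; split=> //.
- by apply/edge_free_coord => j; case: (H j).
- by apply/noncore_factorable_coord => j; case: (H j).
- by apply/balanced_coord => j; have [_ _ b] := H j; split=> //;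
  exact: balanced_core_act.
Qed.

Lemma noncore_irr_blocks :
  phi @` noncore_irr P = \bigcup_(j in setT) irr_block (M := Mj) j.
Proof.
apply/seteqP; split=> [_ [g /noncore_irr_coord[j bj] <-]|f [j _ bj]].
  by exists j.
have [psi _ phiK] := phi_bij; exists (psi f) => //.
by apply/noncore_irr_coord; exists j; rewrite /block /coord phiK.
Qed.

End DirectSumTheory.

Lemma trivIset_irr_block (J : choiceType) (Mj : J -> monoidType) :
  trivIset setT (irr_block (M := Mj)).
Proof.
move=> i j _ _ [f [[[ni _] _] [_ cj]]].
by apply: contrapT => ij; exact/ni/cj.
Qed.

Theorem theorem5p5 (L : graph) (S : L -> monoidType)
    (S_right_LCM : forall w, right_LCM (S w)) :
  let J : choiceType := set_type (coconn_comps L) in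
  let SL : monoidType := graph_product S in
  let SLj : J -> monoidType := fun j => subgraph_product S (val j) in
  (exists phi : SL -> direct_sum SLj,
    [/\ monoid_morphism phi,
        bijective phi,
        forall (j : J) (w : full_subgraph (val j)) (x : S (val w)),
          val (phi (graph_product_in x)) =
            dfwith (fun j' => 1 : SLj j') (subgraph_product_in (w := w) x),
        phi @` noncore_irr SL = \bigcup_(j in setT) irr_block j &
        trivIset setT (irr_block (M := SLj))]) /\
  (edge_free_components (core_graph SL) <->
     forall j, edge_free_components (core_graph (SLj j))) /\
  (noncore_factorable SL <-> forall j, noncore_factorable (SLj j)) /\
  (balanced_factorization SL <->
     forall j, balanced_factorization (SLj j) /\ core_act_restricts (SLj j)) /\
  (has_generalized_scale SL <->
     (forall j, [/\ edge_free_components (core_graph (SLj j)),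
                    noncore_factorable (SLj j) &
                    balanced_factorization (SLj j)]) /\
     freely_generates_nontrivial
       (fun i : {j : J & set_type (coconn_comps (core_graph (SLj j)))} =>
          ncard (val (tagged i)))).
Proof.
move=> J SL SLj.
have SL_LCM : right_LCM SL by exact: graph_product_right_LCM.
have SLj_LCM j : right_LCM (SLj j).
  by apply: graph_product_right_LCM => w; exact: S_right_LCM.
have morph := decomposition_morphism S; have bij := decomposition_bijective S.
split.
  exists (@decomposition L S); split=> //.
  - exact: decomposition_in.
  - exact: noncore_irr_blocks.
  - exact: trivIset_irr_block.
split; first exact: edge_free_coord morph bij SL_LCM SLj_LCM.
split; first exact: noncore_factorable_coord morph bij SL_LCM SLj_LCM.
split; first exact: balanced_coord morph bij SL_LCM SLj_LCM.
exact: has_generalized_scale_coord morph bij SL_LCM SLj_LCM.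
Qed.
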